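(* Let $\alpha$ and $\omega$ be an $R$-Cartan structure and an $(I,0,K)$-generalized Finsler structure, respectively, on the same 3-manifold $\Sigma$. Then there is a unique linear transformation $A:T^*\Sigma\to T^*\Sigma$ with $\omega=A\alpha$ subject to the Foliation Condition and the Identification Condition, and its matrix is $$\begin{pmatrix}\omega^1\\ \omega^2\\ \omega^3\end{pmatrix}=\begin{pmatrix}\left(\frac1m\right)_2&0&\frac1m\\ \frac1m&0&0\\ 0&1&0\end{pmatrix}\begin{pmatrix}\alpha^1\\ \alpha^2\\ \alpha^3\end{pmatrix}.$$ That is, whenever $\alpha$ and $\omega$ satisfy these two conditions (with function $m$), $A$ is necessarily this matrix. In this case the $R$-Cartan structure must obey the condition $$R=1-\frac{m_{22}}{m},$$ where $m$ is a non-vanishing smooth function on $\Sigma$ such that $$m_3=0,\qquad m_{12}=0,$$ and the invariants of $\omega$ are $$I=-2\frac{m_2}{m},\qquad K=m^2.$$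
   Context: An $R$-Cartan structure on a 3-manifold $\Sigma$ ($R$ a smooth function) is a coframing $\alpha=(\alpha^1,\alpha^2,\alpha^3)$ with $d\alpha^1=\alpha^2\wedge\alpha^3$, $d\alpha^2=-\alpha^1\wedge\alpha^3$, $d\alpha^3=R\,\alpha^1\wedge\alpha^2$. An $(I,0,K)$-generalized Finsler structure, or generalized Landsberg structure ($I,K$ smooth functions, called its invariants), is a coframing $\omega=(\omega^1,\omega^2,\omega^3)$ with $d\omega^1=-I\omega^1\wedge\omega^3+\omega^2\wedge\omega^3$, $d\omega^2=-\omega^1\wedge\omega^3$, $d\omega^3=K\omega^1\wedge\omega^2$. Plain subscripts denote directional derivatives with respect to $\alpha$: $df=f_1\alpha^1+f_2\alpha^2+f_3\alpha^3$, and $f_{ij}=(f_i)_j$. Subscripts with $\omega$ denote directional derivatives with respect to $\omega$: $df=f_{\omega1}\omega^1+f_{\omega2}\omega^2+f_{\omega3}\omega^3$. Foliation Condition: the foliation $\{\omega^1=0,\omega^2=0\}$ (indicatrix foliation of $\omega$) coincides with the foliation $\{\alpha^1=0,\alpha^3=0\}$ (geodesic foliation of $\alpha$). Identification Condition: $\alpha^1=m\omega^2$ and $\alpha^2=\omega^3$, where $m$ is a smooth nowhere-vanishing function on $\Sigma$ satisfying $m_{\omega1}=0$ and $m^2=K$. *)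

(* Defs.v *)
From HB Require Import structures.
From mathcomp Require Import all_boot all_order all_algebra.
From mathcomp Require Import all_classical all_reals all_analysis.
Set Implicit Arguments.
Unset Strict Implicit.
Unset Printing Implicit Defensive.
Import Order.TTheory GRing.Theory Num.Theory.
Import numFieldNormedType.Exports.
Local Open Scope classical_set_scope.
Local Open Scope ring_scope.

Definition stdbasis (F : realType) (k : 'I_3) : 'rV[F]_3 := delta_mx 0 k.

(* C^r on [U], which is meant to be open: then only the values of [f] on [U]
   matter for the continuity and the partial derivatives at points of [U]. *)
Fixpoint C_on (F : realType) (V : normedModType F) (r : nat)
    (U : set 'rV[F]_3) (f : 'rV[F]_3 -> V) : Prop :=
  (forall x, U x -> {for x, continuous f}) /\
  if r is r'.+1 then
    forall k : 'I_3, (forall x, U x -> derivable f x (stdbasis F k)) /\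
      C_on r' U (fun x => 'D_(stdbasis F k) f x)
  else True.

Definition smooth_on (F : realType) (V : normedModType F)
    (U : set 'rV[F]_3) (f : 'rV[F]_3 -> V) : Prop := forall r, C_on r U f.

(* A smooth 3-manifold given by an atlas indexed by [chart_index]. The values of
   [chart i] outside [chart_dom i] and those of [chart_inv i] outside
   [chart i @` chart_dom i] are irrelevant. *)
Record manifold3 (F : realType) := Manifold3 {
  points :> topologicalType;
  chart_index : Type;
  chart_dom : chart_index -> set points;
  chart : chart_index -> points -> 'rV[F]_3;
  chart_inv : chart_index -> 'rV[F]_3 -> points;
  manifold_hausdorff : hausdorff_space points;
  manifold_second_countable : @second_countable points;
  chart_dom_cover : forall p, exists i, chart_dom i p;
  chart_dom_open : forall i, open (chart_dom i);
  chart_open : forall i, open (chart i @` chart_dom i);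
  chartK : forall i p, chart_dom i p -> chart_inv i (chart i p) = p;
  chart_continuous : forall i p, chart_dom i p -> {for p, continuous (chart i)};
  chart_inv_continuous : forall i x, (chart i @` chart_dom i) x ->
    {for x, continuous (chart_inv i)};
  transition_smooth : forall i j,
    smooth_on (chart i @` (chart_dom i `&` chart_dom j))
      (chart j \o chart_inv i)
}.

Section Manifold.
Variables (F : realType) (M : manifold3 F).

Definition smooth_fun (f : M -> F) : Prop :=
  forall i : chart_index M,
    smooth_on (chart i @` chart_dom i) (f \o chart_inv i).

(* Row [k] of the matrix is the [k]-th partial derivative of the change of
   coordinates from chart [i] to chart [j]. *)
Definition transition_jacobian (i j : chart_index M) (p : M) : 'M[F]_3 :=
  \matrix_(k < 3, l < 3)
    ('D_(stdbasis F k) (chart j \o chart_inv i) (chart i p)) ord0 l.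

Definition covariant (p : M) (a : chart_index M -> 'cV[F]_3) : Prop :=
  (forall i j, chart_dom i p -> chart_dom j p ->
     a i = transition_jacobian i j p *m a j) /\
  (forall i, ~ chart_dom i p -> a i = 0).

Definition covariantb (p : M) : {pred chart_index M -> 'cV[F]_3} :=
  fun a => `[< covariant p a >].

Fact covariant_submod_closed (p : M) : submod_closed (covariantb p).
Proof.
split.
  by apply/asboolP; split => [i j _ _|//]; rewrite mulmx0.
move=> c a b /asboolP[ha ha0] /asboolP[hb hb0]; apply/asboolP; split.
  move=> i j hi hj.
  transitivity (c *: a i + b i) => //.
  rewrite (ha i j hi hj) (hb i j hi hj).
  by rewrite mulmxDr -scalemxAr.
move=> i hi; transitivity (c *: a i + b i) => //.
by rewrite ha0 // hb0 // scaler0 addr0.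
Qed.

HB.instance Definition _ (p : M) :=
  GRing.isSubmodClosed.Build F (chart_index M -> 'cV[F]_3) (covariantb p)
    (GRing.submod_closed_semi (covariant_submod_closed p)).

(* The cotangent space at [p]: a covector is the family of its component columns
   in all the charts around [p], subject to the covariant transformation law; the
   components in the other charts are set to 0, so that equality of covectors is
   equality of their components in the charts around [p]. *)
Record cotangent (p : M) := Cotangent {
  components :> chart_index M -> 'cV[F]_3;
  components_covariant : components \in covariantb p
}.

HB.instance Definition _ (p : M) := [isSub for @components p].
HB.instance Definition _ (p : M) := [Choice of cotangent p by <:].
HB.instance Definition _ (p : M) :=
  [SubChoice_isSubLmodule of cotangent p by <:].

Definition covector_field := forall p : M, cotangent p.

Definition smooth_form (a : covector_field) : Prop :=
  forall i : chart_index M,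
    smooth_on (chart i @` chart_dom i) (fun x => a (chart_inv i x) i).

(* Components in chart [i] of the exterior derivative at [p]: the entry (k, l)
   is the value on the k-th and l-th coordinate vectors. *)
Definition ext_d (a : covector_field) (i : chart_index M) (p : M) : 'M[F]_3 :=
  \matrix_(k < 3, l < 3)
    (('D_(stdbasis F k) (fun x => a (chart_inv i x) i) (chart i p)) l ord0
     - ('D_(stdbasis F l) (fun x => a (chart_inv i x) i) (chart i p)) k ord0).

(* (a ∧ b)(u, v) = a(u) b(v) - a(v) b(u), the convention matching [ext_d]. *)
Definition wedge (p : M) (a b : cotangent p) (i : chart_index M) : 'M[F]_3 :=
  \matrix_(k < 3, l < 3) (a i k ord0 * b i l ord0 - a i l ord0 * b i k ord0).

Definition differential (f : M -> F) (i : chart_index M) (p : M) : 'cV[F]_3 :=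
  \col_(k < 3) 'D_(stdbasis F k) (f \o chart_inv i) (chart i p).

Definition ix1 : 'I_3 := @Ordinal 3 0 isT.
Definition ix2 : 'I_3 := @Ordinal 3 1 isT.
Definition ix3 : 'I_3 := @Ordinal 3 2 isT.

Definition covector_triple := 'I_3 -> covector_field.

Definition coframing (a : covector_triple) : Prop :=
  (forall j, smooth_form (a j)) /\
  (forall p (c : 'I_3 -> F), \sum_(j < 3) c j *: a j p = 0 ->
     forall j, c j = 0).

(* [dirder a f] is the triple of functions f_1, f_2, f_3 such that
   df = f_1 a^1 + f_2 a^2 + f_3 a^3 (unique, and existing for [f] smooth, when
   [a] is a coframing; the default 0 is used where they do not exist). *)
Definition dirder (a : covector_triple) (f : M -> F) (j : 'I_3) (p : M) : F :=
  xget (0 : 'rV[F]_3)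
    [set c | forall i, chart_dom i p ->
       differential f i p =
         components (\sum_(k < 3) c ord0 k *: a k p) i] ord0 j.

Definition Cartan_structure (R : M -> F) (a : covector_triple) : Prop :=
  [/\ smooth_fun R, coframing a &
   forall p i, chart_dom i p ->
   [/\ ext_d (a ix1) i p = wedge (a ix2 p) (a ix3 p) i,
       ext_d (a ix2) i p = - wedge (a ix1 p) (a ix3 p) i &
       ext_d (a ix3) i p = R p *: wedge (a ix1 p) (a ix2 p) i]].

Definition Landsberg_structure (I K : M -> F) (w : covector_triple) : Prop :=
  [/\ smooth_fun I, smooth_fun K, coframing w &
   forall p i, chart_dom i p ->
   [/\ ext_d (w ix1) i p =
         - I p *: wedge (w ix1 p) (w ix3 p) i + wedge (w ix2 p) (w ix3 p) i,
       ext_d (w ix2) i p = - wedge (w ix1 p) (w ix3 p) i &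
       ext_d (w ix3) i p = K p *: wedge (w ix1 p) (w ix2 p) i]].

(* The foliation {a = 0, b = 0} is represented by its tangent distribution: the
   tangent vectors at [p], given by their component rows in chart [i], on which
   [a] and [b] vanish. *)
Definition foliation_tangent (a b : covector_field) (i : chart_index M)
    (p : M) : set 'rV[F]_3 := [set v | v *m a p i = 0 /\ v *m b p i = 0].

Definition foliation_condition (a w : covector_triple) : Prop :=
  forall p i, chart_dom i p ->
    foliation_tangent (w ix1) (w ix2) i p =
    foliation_tangent (a ix1) (a ix3) i p.

Definition identification_condition (a w : covector_triple) (K m : M -> F) :
    Prop :=
  [/\ forall p, a ix1 p = m p *: w ix2 p, forall p, a ix2 p = w ix3 p,
      smooth_fun m /\ (forall p, m p != 0),
      forall p, dirder w m ix1 p = 0 & forall p, m p ^+ 2 = K p].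

Definition cotangent_endo := forall p : M, {linear cotangent p -> cotangent p}.

Definition maps_coframing (A : cotangent_endo) (a w : covector_triple) : Prop :=
  forall j p, w j p = A p (a j p).

Definition matrix3 (a11 a12 a13 a21 a22 a23 a31 a32 a33 : F) : 'M[F]_3 :=
  \matrix_(j < 3, k < 3)
    nth 0 (nth [::] [:: [:: a11; a12; a13]; [:: a21; a22; a23];
                        [:: a31; a32; a33]] j) k.

(* Row [j] of the matrix lists the coordinates of [A (a^j)] in the coframing. *)
Definition has_matrix (a : covector_triple) (A : cotangent_endo)
    (B : M -> 'M[F]_3) : Prop :=
  forall p j, A p (a j p) = \sum_(k < 3) B p j k *: a k p.

End Manifold.

(* Main.v *)
From HB Require Import structures.
Require Import Defs.
From mathcomp Require Import all_boot all_order all_algebra.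
From mathcomp Require Import all_classical all_reals all_analysis.
From mathcomp Require Import ring lra.
Set Implicit Arguments.
Unset Strict Implicit.
Unset Printing Implicit Defensive.
Import Order.TTheory GRing.Theory Num.Theory.
Import numFieldNormedType.Exports.
Local Open Scope classical_set_scope.
Local Open Scope ring_scope.

(** The foliation condition makes omega^1 a combination
    p alpha^1 + q alpha^3, so both coframings can be compared in the basis
    alpha^1/\alpha^2, alpha^1/\alpha^3, alpha^2/\alpha^3 of 2-forms.

    Differentiating alpha^1 = m omega^2 and comparing coefficients gives
    q = 1/m, m_3 = 0 and p = - m_2/m^2 = (1/m)_2 ([pair_first_order]): this is
    the matrix of the transformation, which is unique because alpha is a
    coframing.  Differentiating the resulting formula for omega^1 gives
    I = - 2 m_2/m and R = 1 - m_22/m ([pair_second_order]).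

    The condition m_12 = 0 ([pair_m12_eq0]) lies one order deeper.  From
    d(dm) = 0 come m_12 = m_21 and m_23 = m_1, and from d(d omega^1) = 0 comes
    dI /\ omega^1 /\ omega^3 = 0 ([landsberg_bianchi]), that is
    m I_1 = - m_2 I_3.  Inserting I = - 2 m_2/m turns this into
    m_21 = 0.

    These computations are made in a chart.  They need d(d u) = 0, hence the
    symmetry of second derivatives ([symmetric_mixed_derivatives]), proved by
    expressing a second difference through the mean value theorem in two ways.
    Directional derivatives along a coframing are defined by an equation
    between covectors, which refers to all the charts at once; that solving it
    in one chart is enough is the chain rule for the changes of coordinates
    ([differential_transition]), applicable because a function with continuous
    partial derivatives is differentiable
    ([partials_continuous_differentiable]). *)

(** * Symmetry of second derivatives and differentiability from partials *)

Lemma is_derive_line (F : realType) (V : normedModType F) (f : V -> F)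
    (x v : V) (s : F) :
  derivable f (x + s *: v) v ->
  is_derive s 1 (fun t => f (x + t *: v)) ('D_v f (x + s *: v)).
Proof.
move=> df.
have E : (fun h : F => h^-1 *: (((fun t => f (x + t *: v)) \o shift s) (h *: 1)
     - f (x + s *: v))) =
   (fun h => h^-1 *: ((f \o shift (x + s *: v)) (h *: v) - f (x + s *: v))).
  apply/funext => h /=; congr (_ *: (f _ - _)).
  by rewrite [h *: 1]mulr1 scalerDl addrCA.
split; last by rewrite /derive E.
by rewrite /derivable E.
Qed.

Lemma directional_mean_value (F : realType) (V : normedModType F) (f : V -> F)
    (x v : V) (t : F) :
  (forall s, `|s| <= `|t| -> derivable f (x + s *: v) v) ->
  exists2 s, `|s| <= `|t| & f (x + t *: v) - f x = t * 'D_v f (x + s *: v).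
Proof.
have pos (y : V) (r : F) : 0 <= r ->
    (forall s, 0 <= s <= r -> derivable f (y + s *: v) v) ->
  exists2 s, 0 <= s <= r & f (y + r *: v) - f y = r * 'D_v f (y + s *: v).
  move=> r0 df.
  have dl s : s \in `[0, r] -> is_derive s 1 (fun t => f (y + t *: v))
                                 ('D_v f (y + s *: v)).
    by move=> sr; apply/is_derive_line/df.
  have dlo s : s \in `]0, r[ -> is_derive s 1 (fun t => f (y + t *: v))
                                  ('D_v f (y + s *: v)).
    by move=> sr; apply: dl; apply: subset_itv_oo_cc sr.
  have cl : {within `[0, r], continuous (fun t => f (y + t *: v))}.
    by apply: derivable_within_continuous => s /dl [].
  have [s sr] := MVT_segment r0 dlo cl.
  by rewrite scale0r addr0 subr0 mulrC => e; exists s.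
move=> df; have [t0|t0] := leP 0 t.
  have [|s sr e] := pos x t t0.
    move=> s /andP[s0 st]; apply: df.
    by rewrite !ger0_norm.
  by exists s => //; move/andP: sr => [s0 st]; rewrite !ger0_norm.
(* for a negative step, run the segment backwards from its other end *)
have [||s /andP[s0 st] e] := pos (x + t *: v) (- t).
- by rewrite oppr_ge0 ltW.
- move=> s /andP[s0 st]; rewrite -addrA -scalerDl; apply: df.
  by rewrite ler_norml (ltr0_norm t0); lra.
exists (t + s); first by rewrite ler_norml (ltr0_norm t0); lra.
move: e; rewrite -addrA -scalerDl subrr scale0r addr0 -addrA -scalerDl => e.
by rewrite -opprB e mulNr opprK.
Qed.

(** The mean value theorem in direction [u] for the increment of [f] along
    [h *: v], and then in direction [v] for its derivative. *)
Lemma second_difference (F : realType) (V : normedModType F) (f : V -> F)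
    (x u v : V) (h : F) :
  (forall s r, `|s| <= `|h| -> `|r| <= `|h| ->
     derivable f (x + s *: u + r *: v) u /\
     derivable ('D_u f) (x + s *: u + r *: v) v) ->
  exists s r, [/\ `|s| <= `|h|, `|r| <= `|h| &
   f (x + h *: u + h *: v) - f (x + h *: u) - (f (x + h *: v) - f x) =
   h * h * 'D_v ('D_u f) (x + s *: u + r *: v)].
Proof.
move=> df.
have h0 : `|0 : F| <= `|h| by rewrite normr0.
pose g := (f \o shift (h *: v)) \- f.
have dsh s : `|s| <= `|h| ->
    is_derive (x + s *: u) u (f \o shift (h *: v))
      ('D_u f (x + s *: u + h *: v)).
  move=> sh; have [d _] := df s h sh (lexx _).
  have E : (fun k : F => k^-1 *: (((f \o shift (h *: v)) \o shift (x + s *: u))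
                 (k *: u) - (f \o shift (h *: v)) (x + s *: u))) =
     (fun k => k^-1 *: ((f \o shift (x + s *: u + h *: v)) (k *: u)
                        - f (x + s *: u + h *: v))).
    by apply/funext => k /=; rewrite !addrA.
  by split; [rewrite /derivable E|rewrite /derive E].
have dg s : `|s| <= `|h| -> derivable g (x + s *: u) u.
  move=> sh; have [d1 _] := dsh s sh.
  have [d2 _] := df s 0 sh h0; rewrite scale0r addr0 in d2.
  exact: derivableB d1 d2.
have [s sh es] := @directional_mean_value F V g x u h dg.
have := es; rewrite deriveB; last 2 first.
- by have [] := dsh s sh.
- by have [] := df s 0 sh h0; rewrite scale0r addr0.
have -> := @derive_val _ _ _ _ _ _ _ (dsh s sh).
have [|r rh er] := @directional_mean_value F V ('D_u f) (x + s *: u) v h.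
  by move=> r rh; have [] := df s r sh rh.
rewrite er /g /= mulrA => e; exists s, r; split=> //.
Qed.

(** The second difference of [f] is symmetric in [u] and [v], and is [h * h]
    times a value of either mixed derivative near [x]; continuity at [x] then
    forces the two to agree. *)
Lemma symmetric_mixed_derivatives (F : realType) (V : normedModType F)
    (f : V -> F) (x u v : V) :
  (\forall y \near x, derivable f y u) ->
  (\forall y \near x, derivable f y v) ->
  (\forall y \near x, derivable ('D_u f) y v) ->
  (\forall y \near x, derivable ('D_v f) y u) ->
  {for x, continuous ('D_v ('D_u f))} ->
  {for x, continuous ('D_u ('D_v f))} ->
  'D_v ('D_u f) x = 'D_u ('D_v f) x.
Proof.
move=> fu fv fuv fvu cuv cvu.
apply/eqP; rewrite -subr_eq0 -normr_le0; apply/ler_addgt0Pr => e e0.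
rewrite add0r.
have close (a b c : F) :
    `|a - c| <= e / 2 -> `|b - c| <= e / 2 -> `|a - b| <= e.
  by rewrite !ler_norml; lra.
have e20 : 0 < e / 2 by rewrite divr_gt0.
have /cvgrPdist_le /(_ _ e20) nuv := cuv.
have /cvgrPdist_le /(_ _ e20) nvu := cvu.
have [d d0 hd] := (nbhs_ballP x _).1
  (filterI (filterI (filterI fu fv) (filterI fuv fvu)) (filterI nuv nvu)).
(* the square of side h is to stay in the ball of radius d; adding 1 covers
   the case where u and v both vanish *)
pose c := `|u| + `|v| + 1.
have c0 : 0 < c by rewrite /c ltr_wpDl // addr_ge0.
pose h := d / 2 / c.
have h0 : 0 < h by rewrite /h !divr_gt0.
have inb s r : `|s| <= `|h| -> `|r| <= `|h| -> ball x d (x + s *: u + r *: v).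
  rewrite (gtr0_norm h0) => sh rh; rewrite -ball_normE /= distrC.
  rewrite -(addrA x) (addrC x) addrK.
  apply: (@le_lt_trans _ _ (h * (`|u| + `|v|))).
    rewrite (le_trans (ler_normD _ _)) // !normrZ mulrDr.
    by rewrite lerD // ler_wpM2r.
  apply: (@lt_trans _ _ (h * c)); first by rewrite ltr_pM2l // /c ltrDl.
  by rewrite /h divfK ?gt_eqF // ltr_pdivrMr // mulr_natr mulr2n ltrDl.
have [|s [r [sh rh E1]]] := @second_difference F V f x u v h.
  move=> s r sh rh; have [[[du _] [duv _]] _] := hd _ (inb s r sh rh).
  exact: (conj du duv).
have [|s' [r' [sh' rh' E2]]] := @second_difference F V f x v u h.
  move=> s' r' sh' rh'; have := inb r' s' rh' sh'.
  rewrite addrAC => B; have [[[_ dv] [_ dvu]] _] := hd _ B.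
  exact: (conj dv dvu).
have hh0 : h * h != 0 by rewrite mulf_neq0 // gt_eqF.
have cancel (k a b p q A B : F) : k != 0 ->
    a - b - (p - q) = k * A -> a - p - (b - q) = k * B -> A = B.
  by move=> k0 eA eB; apply: (mulfI k0); rewrite -eA -eB; ring.
rewrite (addrAC x (h *: v)) in E2.
have E := cancel _ _ _ _ _ _ _ hh0 E1 E2.
have [_ [A _]] := hd _ (inb s r sh rh).
have := inb r' s' rh' sh'; rewrite addrAC => B'; have [_ [_ B]] := hd _ B'.
rewrite -E in B.
exact: close A B.
Qed.

(** The increment of [f] is split into steps along the coordinate axes; by the
    mean value theorem each step is the product of a coordinate of the increment
    and a partial derivative at a nearby point. *)
Lemma partials_continuous_differentiable (F : realType) (n : nat)
    (f : 'rV[F]_n -> F) (x : 'rV[F]_n) :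
  (forall k, \forall y \near x, derivable f y (delta_mx 0 k)) ->
  (forall k, {for x, continuous ('D_(delta_mx 0 k) f)}) ->
  differentiable f x.
Proof.
move=> df cf.
pose e k : 'rV[F]_n := delta_mx 0 k.
pose L (h : 'rV[F]_n) : F := \sum_k h 0 k * 'D_(e k) f x.
have linL : linear L.
  move=> c u v; rewrite /L scaler_sumr -big_split; apply: eq_bigr => k _ /=.
  by rewrite !mxE mulrDl -mulrA.
pose mixin := GRing.isLinear.Build F 'rV[F]_n F *:%R L linL.
pose LL : {linear 'rV[F]_n -> F} := HB.pack L mixin.
have cL : continuous LL.
  move=> h; apply: differentiable_continuous.
  have -> : (LL : 'rV[F]_n -> F) =
      \sum_k (fun h : 'rV[F]_n => (h 0 k : F) * 'D_(e k) f x).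
    by apply/funext => g; rewrite fct_sumE.
  apply: differentiable_sum => k; apply: differentiableM => //.
  exact: differentiable_coord.
have dL : f \o shift x = cst (f x) + (LL : 'rV[F]_n -> F) +o_ (0 : 'rV[F]_n) id.
  apply/eqaddoP => eps eps0.
  pose E := eps / n.+1%:R.
  have E0 : 0 < E by rewrite divr_gt0.
  have /nbhs_ballP [d /= d0 hd] : \forall y \near x, forall k,
     derivable f y (e k) /\ `|'D_(e k) f x - 'D_(e k) f y| <= E.
    apply: (@filter_forall _ _ (fun k y => derivable f y (e k) /\
       `|'D_(e k) f x - 'D_(e k) f y| <= E) (nbhs x) (nbhs_filter x)) => k.
    have /cvgrPdist_le /(_ _ E0) c := cf k.
    by apply: (@filterS _ (nbhs x) (nbhs_filter x) _ _ _
                 (filterI (df k) c)) => y [].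
  apply/nbhs_ballP; exists d => // h hb.
  have hsmall : `|h| < d.
    have : ball (0 : 'rV[F]_n) d h by exact: hb.
    by rewrite -ball_normE /= sub0r normrN.
  (* P k keeps the first k coordinates of the increment h *)
  pose P (k : nat) : 'rV[F]_n := \row_j (if (j < k)%N then h 0 j else 0).
  have hj j : `|h 0 j| <= `|h|.
    rewrite [leRHS]/Num.Def.normr /= mx_normrE.
    exact: (le_bigmax _ _ (0, j)).
  have Ps (k : 'I_n) : P k.+1 = P k + h 0 k *: e k.
    apply/rowP => j; rewrite !mxE eqxx /= ltnS leq_eqVlt.
    have [jk|jk] := eqVneq (val j) (val k); last first.
      by rewrite -(inj_eq val_inj) (negPf jk) mulr0 addr0.
    by rewrite (ord_inj jk) eqxx ltnn add0r mulr1.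
  have step (k : 'I_n) : exists2 s, ball x d (x + P k + s *: e k) &
      f (x + P k.+1) - f (x + P k) = h 0 k * 'D_(e k) f (x + P k + s *: e k).
    have inb s : `|s| <= `|h 0 k| -> ball x d (x + P k + s *: e k).
      move=> sh; rewrite -ball_normE /= distrC -(addrA x) (addrC x) addrK.
      apply: le_lt_trans hsmall.
      rewrite [leLHS]/Num.Def.normr /= mx_normrE.
      apply/bigmax_leP; split=> [|[i j] _ /=]; first exact: normr_ge0.
      rewrite !mxE ord1 eqxx /=.
      have [->|jk] := eqVneq j k.
        by rewrite ltnn add0r mulr1 (le_trans sh).
      by rewrite mulr0 addr0; case: ifP; rewrite ?normr0.
    rewrite Ps addrA.
    have [|s sh es] :=
      @directional_mean_value F _ f (x + P k) (e k) (h 0 k).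
      by move=> s sh; have [] := hd _ (inb s sh) k.
    by exists s => //; exact: inb.
  have tel : f (h + x) - f x = \sum_(k < n) (f (x + P k.+1) - f (x + P k)).
    rewrite -(big_mkord xpredT (fun k => f (x + P k.+1) - f (x + P k))).
    rewrite telescope_sumr //; congr (f _ - f _).
      by rewrite addrC; congr (_ + _); apply/rowP => j; rewrite mxE ltn_ord.
    by rewrite -[LHS]addr0; congr (_ + _); apply/rowP => j; rewrite !mxE.
  rewrite -[X in `|X|]/(f (h + x) - (f x + L h)) opprD addrA tel /L -sumrB.
  apply: (le_trans (ler_norm_sum _ _ _)).
  apply: (@le_trans _ _ (\sum_(k < n) (E * `|h|))).
    apply: ler_sum => k _; have [s sb ->] := step k.
    have [_ de] := hd _ sb k.
    by rewrite -mulrBr normrM mulrC ler_pM // distrC.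
  rewrite sumr_const card_ord -mulr_natl mulrA ler_wpM2r // /E mulrCA.
  rewrite ger_pMr // ler_pdivrMr // mul1r ler_nat.
  exact: leqnSn.
apply/diff_locallyP; rewrite (diff_unique cL dL); split; last exact: dL.
exact: cL.
Qed.

(** * Calculus of smooth functions on open subsets of coordinate space *)

(** The partial derivatives at a point of an open set depend only on the values
    of the function on that set, so the property passes to all orders. *)
Lemma C_on_eq (F : realType) (V : normedModType F) (r : nat)
    (U : set 'rV[F]_3) (f g : 'rV[F]_3 -> V) :
  open U -> (forall x, U x -> f x = g x) -> C_on r U f -> C_on r U g.
Proof.
move=> oU; elim: r f g => [|r IH] f g fg [cf df].
all: have nfg x : U x -> \forall y \near x, f y = g y
  by move=> Ux; apply: filterS (open_nbhs_nbhs (conj oU Ux)).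
all: have cg x : U x -> {for x, continuous g}
  by move=> Ux; suff : g @ x --> g x by []; rewrite -(fg x Ux);
     exact: cvg_trans (near_eq_cvg (nfg x Ux)) (cf x Ux).
- by split.
split=> // k; have [dfk Ck] := df k; split.
  by move=> x Ux; apply: near_eq_derivable (dfk x Ux); exact: nfg.
by apply: IH Ck => x Ux; apply: near_eq_derive; exact: nfg.
Qed.

Lemma derive_entry (F : realType) (m n : nat) (V : normedModType F)
    (u : V -> 'M[F]_(m, n)) (x v : V) i j :
  derivable u x v -> ('D_v u x) i j = 'D_v (fun y => u y i j) x.
Proof. by move=> du; rewrite derive_mx // mxE. Qed.

Lemma C_on_entry (F : realType) (m n : nat) (r : nat) (U : set 'rV[F]_3)
    (u : 'rV[F]_3 -> 'M[F]_(m, n)) i j :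
  open U -> C_on r U u -> C_on r U (fun x => u x i j).
Proof.
move=> oU; elim: r u => [|r IH] u [cu du].
all: have cij x : U x -> {for x, continuous (fun y => u y i j)}
  by move=> Ux; exact: (@continuous_comp _ _ _ u
       (fun N : 'M[F]_(m, n) => N i j : F) x (cu x Ux)
       (differentiable_continuous (differentiable_coord (u x) i j))).
- by split.
split=> // k; have [duk Ck] := du k.
split; first by move=> x Ux; exact: (iffLR (derivable_mxP u x _) (duk x Ux)).
apply: C_on_eq oU _ (IH _ Ck) => x Ux; exact: (derive_entry _ _ (duk x Ux)).
Qed.

Lemma smooth_entry (F : realType) (m n : nat) (U : set 'rV[F]_3)
    (u : 'rV[F]_3 -> 'M[F]_(m, n)) i j :
  open U -> smooth_on U u -> smooth_on U (fun x => u x i j).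
Proof. by move=> oU su r; apply: C_on_entry oU (su r). Qed.

Lemma smooth_partial (F : realType) (V : normedModType F) (U : set 'rV[F]_3)
    (f : 'rV[F]_3 -> V) k :
  smooth_on U f -> smooth_on U ('D_(stdbasis F k) f).
Proof. by move=> sf r; have [_ /(_ k) []] := sf r.+1. Qed.

Lemma smooth_derivable (F : realType) (V : normedModType F) (U : set 'rV[F]_3)
    (f : 'rV[F]_3 -> V) k x :
  smooth_on U f -> U x -> derivable f x (stdbasis F k).
Proof. by move=> sf Ux; have [_ /(_ k) [df _]] := sf 1%N; exact: df. Qed.

Lemma smooth_continuous (F : realType) (V : normedModType F) (U : set 'rV[F]_3)
    (f : 'rV[F]_3 -> V) x :
  smooth_on U f -> U x -> {for x, continuous f}.
Proof. by move=> sf Ux; have [cf _] := sf 0%N; exact: cf. Qed.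

Lemma smooth_differentiable (F : realType) (U : set 'rV[F]_3)
    (f : 'rV[F]_3 -> F) x :
  open U -> smooth_on U f -> U x -> differentiable f x.
Proof.
move=> oU sf Ux; apply: partials_continuous_differentiable => k.
  apply: filterS (open_nbhs_nbhs (conj oU Ux)) => y Uy.
  exact: smooth_derivable sf Uy.
exact: smooth_continuous (smooth_partial k sf) Ux.
Qed.

Lemma smooth_symmetric_partials (F : realType) (U : set 'rV[F]_3)
    (f : 'rV[F]_3 -> F) k l x :
  open U -> smooth_on U f -> U x ->
  'D_(stdbasis F k) ('D_(stdbasis F l) f) x =
  'D_(stdbasis F l) ('D_(stdbasis F k) f) x.
Proof.
move=> oU sf Ux.
have nd (g : 'rV[F]_3 -> F) j : smooth_on U g ->
    \forall y \near x, derivable g y (stdbasis F j).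
  move=> sg; apply: filterS (open_nbhs_nbhs (conj oU Ux)) => y Uy.
  exact: smooth_derivable sg Uy.
have sd j := smooth_partial j sf.
apply: symmetric_mixed_derivatives.
- exact: nd sf.
- exact: nd sf.
- exact: nd (sd l).
- exact: nd (sd k).
- exact: smooth_continuous (smooth_partial k (sd l)) Ux.
- exact: smooth_continuous (smooth_partial l (sd k)) Ux.
Qed.

(** Only the restriction of [h] to a line enters, so derivability of [h] along
    [v] is enough, in contrast with the chain rule for differentials. *)
Lemma derive_comp_differentiable (F : realType) (V W X : normedModType F)
    (h : V -> W) (g : W -> X) (x v : V) :
  derivable h x v -> differentiable g (h x) ->
  'D_v (g \o h) x = 'd g (h x) ('D_v h x).
Proof.
move=> dh dg.
pose l (t : F) : W := h (t *: v + x).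
have l0 : l 0 = h x by rewrite /l scale0r add0r.
have dl : differentiable l (0 : F).
  by apply/derivable1_diffP; exact: (iffLR (derivable1P h x v) dh).
have line (Y : normedModType F) (k : V -> Y) :
    'D_v k x = 'D_1 (fun t : F => k (t *: v + x)) 0.
  rewrite /derive.
  set q1 := fun t => t^-1 *: _; set q2 := fun t => t^-1 *: _.
  suff -> : q1 = q2 by [].
  by apply/funext => t; rewrite /q1 /q2 /= addr0 scale0r add0r [t%:A]mulr1.
rewrite (line _ h) (line _ (g \o h)) -[fun t => (g \o h) _]/(g \o l).
rewrite -[fun t => h _]/l -l0 in dg *.
have dgl : differentiable (g \o l) (0 : F) := differentiable_comp dl dg.
by rewrite (deriveE (1 : F) dgl) (diff_comp dl dg) (deriveE (1 : F) dl).
Qed.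

Lemma differential_partials (F : realType) (g : 'rV[F]_3 -> F)
    (x v : 'rV[F]_3) :
  differentiable g x ->
  'd g x v = \sum_(k < 3) v 0 k * 'D_(stdbasis F k) g x.
Proof.
move=> dg; rewrite [in LHS](row_sum_delta v) linear_sum; apply: eq_bigr => k _.
by rewrite linearZ deriveE.
Qed.

(** * Exterior calculus in coordinates *)

(** 1-forms are columns of components, in agreement with [cotangent]. *)
Definition form_differentiable (F : realType) (u : 'rV[F]_3 -> 'cV[F]_3)
    (x : 'rV[F]_3) : Prop := forall l, differentiable (fun y => u y l ord0) x.

Definition grad (F : realType) (f : 'rV[F]_3 -> F) (x : 'rV[F]_3) : 'cV[F]_3 :=
  \col_(k < 3) 'D_(stdbasis F k) f x.

(** The exterior derivative of a 1-form, as an antisymmetric matrix. *)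
Definition ext_d1 (F : realType) (u : 'rV[F]_3 -> 'cV[F]_3) (x : 'rV[F]_3) :
    'M[F]_3 :=
  \matrix_(k < 3, l < 3)
    ('D_(stdbasis F k) u x l ord0 - 'D_(stdbasis F l) u x k ord0).

Definition wedge11 (F : realType) (u v : 'cV[F]_3) : 'M[F]_3 :=
  \matrix_(k < 3, l < 3) (u k ord0 * v l ord0 - u l ord0 * v k ord0).

(** The component along dx1/\dx2/\dx3 of the wedge of a 2-form and a 1-form. *)
Definition wedge21 (F : realType) (W : 'M[F]_3) (v : 'cV[F]_3) : F :=
  W ix2 ix3 * v ix1 ord0 + W ix3 ix1 * v ix2 ord0 + W ix1 ix2 * v ix3 ord0.

(** The component along dx1/\dx2/\dx3 of the exterior derivative of a 2-form,
    itself given by an antisymmetric matrix. *)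
Definition ext_d2 (F : realType) (W : 'rV[F]_3 -> 'M[F]_3) (x : 'rV[F]_3) : F :=
  'D_(stdbasis F ix1) (fun y => W y ix2 ix3) x +
  'D_(stdbasis F ix2) (fun y => W y ix3 ix1) x +
  'D_(stdbasis F ix3) (fun y => W y ix1 ix2) x.

Lemma scalemxE (F : realType) (m n : nat) (c : F) (A : 'M[F]_(m, n)) i j :
  (c *: A) i j = c * A i j.
Proof. exact: mxE. Qed.

Lemma gradE (F : realType) (f : 'rV[F]_3 -> F) (x : 'rV[F]_3) k :
  grad f x k ord0 = 'D_(stdbasis F k) f x.
Proof. exact: mxE. Qed.

Lemma wedge11E (F : realType) (u v : 'cV[F]_3) k l :
  wedge11 u v k l = u k ord0 * v l ord0 - u l ord0 * v k ord0.
Proof. exact: mxE. Qed.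

Lemma form_derivable (F : realType) (u : 'rV[F]_3 -> 'cV[F]_3)
    (x v : 'rV[F]_3) :
  form_differentiable u x -> derivable u x v.
Proof.
move=> du; apply/derivable_mxP => i j; rewrite ord1.
exact: diff_derivable (du i).
Qed.

Lemma derive_form (F : realType) (u : 'rV[F]_3 -> 'cV[F]_3) (x v : 'rV[F]_3) l :
  form_differentiable u x ->
  'D_v u x l ord0 = 'D_v (fun y => u y l ord0) x.
Proof. by move=> du; apply: derive_entry; exact: form_derivable. Qed.

Lemma ext_d1E (F : realType) (u : 'rV[F]_3 -> 'cV[F]_3) (x : 'rV[F]_3) k l :
  form_differentiable u x ->
  ext_d1 u x k l = 'D_(stdbasis F k) (fun y => u y l ord0) x -
                 'D_(stdbasis F l) (fun y => u y k ord0) x.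
Proof.
move=> du; rewrite -!(derive_form _ _ du).
exact: mxE.
Qed.

Lemma derive_mul (F : realType) (f g : 'rV[F]_3 -> F) (x v : 'rV[F]_3) :
  differentiable f x -> differentiable g x ->
  'D_v (fun y => f y * g y) x = f x * 'D_v g x + g x * 'D_v f x.
Proof.
by move=> df dg; exact: deriveM (diff_derivable df) (diff_derivable dg).
Qed.

Lemma derive_add (F : realType) (f g : 'rV[F]_3 -> F) (x v : 'rV[F]_3) :
  differentiable f x -> differentiable g x ->
  'D_v (fun y => f y + g y) x = 'D_v f x + 'D_v g x.
Proof.
by move=> df dg; exact: deriveD (diff_derivable df) (diff_derivable dg).
Qed.

Lemma derive_sub (F : realType) (f g : 'rV[F]_3 -> F) (x v : 'rV[F]_3) :
  differentiable f x -> differentiable g x ->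
  'D_v (fun y => f y - g y) x = 'D_v f x - 'D_v g x.
Proof.
by move=> df dg; exact: deriveB (diff_derivable df) (diff_derivable dg).
Qed.

Lemma form_differentiableZ (F : realType) (f : 'rV[F]_3 -> F)
    (u : 'rV[F]_3 -> 'cV[F]_3) (x : 'rV[F]_3) :
  differentiable f x -> form_differentiable u x ->
  form_differentiable (fun y => f y *: u y) x.
Proof.
move=> df du l.
have -> : (fun y => (f y *: u y) l ord0) = f * (fun y => u y l ord0).
  by apply/funext => y; rewrite mxE.
exact: differentiableM df (du l).
Qed.

Lemma form_differentiableD (F : realType) (u v : 'rV[F]_3 -> 'cV[F]_3)
    (x : 'rV[F]_3) :
  form_differentiable u x -> form_differentiable v x ->
  form_differentiable (fun y => u y + v y) x.
Proof.
move=> du dv l.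
have -> : (fun y => (u y + v y) l ord0) =
    (fun y => u y l ord0) + (fun y => v y l ord0).
  by apply/funext => y; rewrite mxE.
exact: differentiableD (du l) (dv l).
Qed.

Lemma near_eq_grad (F : realType) (f g : 'rV[F]_3 -> F) (x : 'rV[F]_3) :
  (\forall y \near x, f y = g y) -> grad f x = grad g x.
Proof.
by move=> fg; apply/colP => k; rewrite !mxE; exact: near_eq_derive fg.
Qed.

Lemma near_eq_ext_d1 (F : realType) (u v : 'rV[F]_3 -> 'cV[F]_3)
    (x : 'rV[F]_3) :
  (\forall y \near x, u y = v y) -> ext_d1 u x = ext_d1 v x.
Proof.
move=> uv; apply/matrixP => k l; transitivity
  ('D_(stdbasis F k) u x l ord0 - 'D_(stdbasis F l) u x k ord0).
  exact: mxE.
by rewrite !(near_eq_derive _ uv); symmetry; exact: mxE.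
Qed.

Lemma near_eq_ext_d2 (F : realType) (W Z : 'rV[F]_3 -> 'M[F]_3) (x : 'rV[F]_3) :
  (\forall y \near x, W y = Z y) -> ext_d2 W x = ext_d2 Z x.
Proof.
move=> WZ; have e k l v : 'D_v (fun y => W y k l) x = 'D_v (fun y => Z y k l) x.
  by apply: near_eq_derive; apply: filterS WZ => y ->.
by rewrite /ext_d2 !e.
Qed.

Lemma gradM (F : realType) (f g : 'rV[F]_3 -> F) (x : 'rV[F]_3) :
  differentiable f x -> differentiable g x ->
  grad (fun y => f y * g y) x = f x *: grad g x + g x *: grad f x.
Proof.
move=> df dg; apply/colP => k; rewrite gradE (derive_mul _ df dg) [RHS]mxE.
by rewrite !scalemxE !gradE.
Qed.

Lemma ext_d1Z (F : realType) (f : 'rV[F]_3 -> F) (u : 'rV[F]_3 -> 'cV[F]_3)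
    (x : 'rV[F]_3) :
  differentiable f x -> form_differentiable u x ->
  ext_d1 (fun y => f y *: u y) x = wedge11 (grad f x) (u x) + f x *: ext_d1 u x.
Proof.
move=> df du; have dfu := form_differentiableZ df du.
have e l : (fun y => (f y *: u y) l ord0) = (fun y => f y * u y l ord0).
  by apply/funext => y; rewrite mxE.
apply/matrixP => k l; rewrite (ext_d1E _ _ dfu) !e !(derive_mul _ df (du _)).
rewrite [RHS]mxE wedge11E scalemxE (ext_d1E _ _ du) !gradE.
ring.
Qed.

Lemma ext_d1D (F : realType) (u v : 'rV[F]_3 -> 'cV[F]_3) (x : 'rV[F]_3) :
  form_differentiable u x -> form_differentiable v x ->
  ext_d1 (fun y => u y + v y) x = ext_d1 u x + ext_d1 v x.
Proof.
move=> du dv; have duv := form_differentiableD du dv.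
have e l : (fun y => (u y + v y) l ord0) = (fun y => u y l ord0 + v y l ord0).
  by apply/funext => y; rewrite mxE.
apply/matrixP => k l; rewrite (ext_d1E _ _ duv) !e.
rewrite !(derive_add _ (du _) (dv _)).
rewrite [RHS]mxE (ext_d1E _ _ du) (ext_d1E _ _ dv).
ring.
Qed.

Lemma grad_differentiable (F : realType) (U : set 'rV[F]_3) (f : 'rV[F]_3 -> F)
    (x : 'rV[F]_3) :
  open U -> smooth_on U f -> U x -> form_differentiable (grad f) x.
Proof.
move=> oU sf Ux l.
have -> : (fun y => grad f y l ord0) = 'D_(stdbasis F l) f.
  by apply/funext => y; rewrite mxE.
exact: smooth_differentiable oU (smooth_partial l sf) Ux.
Qed.

Lemma ext_d1_grad (F : realType) (U : set 'rV[F]_3) (f : 'rV[F]_3 -> F)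
    (x : 'rV[F]_3) :
  open U -> smooth_on U f -> U x -> ext_d1 (grad f) x = 0.
Proof.
move=> oU sf Ux; have dg := grad_differentiable oU sf Ux.
have e l : (fun y => grad f y l ord0) = 'D_(stdbasis F l) f.
  by apply/funext => y; rewrite mxE.
apply/matrixP => k l; rewrite (ext_d1E _ _ dg) !e [RHS]mxE.
by rewrite (smooth_symmetric_partials k l oU sf Ux) subrr.
Qed.

Lemma smooth_form_differentiable (F : realType) (U : set 'rV[F]_3)
    (u : 'rV[F]_3 -> 'cV[F]_3) (x : 'rV[F]_3) :
  open U -> smooth_on U u -> U x -> form_differentiable u x.
Proof.
move=> oU su Ux l.
exact: smooth_differentiable oU (smooth_entry l ord0 oU su) Ux.
Qed.

Lemma derive_ext_d1 (F : realType) (U : set 'rV[F]_3)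
    (u : 'rV[F]_3 -> 'cV[F]_3) (x v : 'rV[F]_3) k l :
  open U -> smooth_on U u -> U x ->
  'D_v (fun y => ext_d1 u y k l) x =
  'D_v ('D_(stdbasis F k) (fun y => u y l ord0)) x -
  'D_v ('D_(stdbasis F l) (fun y => u y k ord0)) x.
Proof.
move=> oU su Ux.
have d i j : differentiable ('D_(stdbasis F i) (fun y => u y j ord0)) x.
  apply: (smooth_differentiable oU _ Ux).
  exact: smooth_partial (smooth_entry j ord0 oU su).
rewrite -derive_sub; [|exact: d|exact: d].
apply: near_eq_derive; apply: filterS (open_nbhs_nbhs (conj oU Ux)) => y Uy.
by rewrite (ext_d1E _ _ (smooth_form_differentiable oU su Uy)).
Qed.

Lemma ext_d2_ext_d1 (F : realType) (U : set 'rV[F]_3)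
    (u : 'rV[F]_3 -> 'cV[F]_3) (x : 'rV[F]_3) :
  open U -> smooth_on U u -> U x -> ext_d2 (ext_d1 u) x = 0.
Proof.
move=> oU su Ux; rewrite /ext_d2 !(derive_ext_d1 _ _ _ oU su Ux).
have s i j l := smooth_symmetric_partials i j oU
  (smooth_entry l ord0 oU su) Ux.
have cyc (a b c a' b' c' : F) : a = a' -> b = b' -> c = c' ->
    a - b' + (c - a') + (b - c') = 0.
  by move=> -> -> ->; ring.
exact: (cyc _ _ _ _ _ _ (s ix1 ix2 ix3) (s ix3 ix1 ix2) (s ix2 ix3 ix1)).
Qed.

(** The graded Leibniz rule d(u/\v) = du/\v - u/\dv; a 2-form and a 1-form
    commute, hence the order of the factors in the last term. *)
Lemma ext_d2_wedge11 (F : realType) (u v : 'rV[F]_3 -> 'cV[F]_3)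
    (x : 'rV[F]_3) :
  form_differentiable u x -> form_differentiable v x ->
  ext_d2 (fun y => wedge11 (u y) (v y)) x =
  wedge21 (ext_d1 u x) (v x) - wedge21 (ext_d1 v x) (u x).
Proof.
move=> du dv.
have e k l : (fun y => wedge11 (u y) (v y) k l) =
    (fun y => u y k ord0 * v y l ord0 - u y l ord0 * v y k ord0).
  by apply/funext => y; rewrite mxE.
have dm k l : differentiable (fun y => u y k ord0 * v y l ord0) x.
  exact: differentiableM (du k) (dv l).
rewrite /ext_d2 !e !(derive_sub _ (dm _ _) (dm _ _)).
rewrite !(derive_mul _ (du _) (dv _)) /wedge21.
rewrite !(ext_d1E _ _ du) !(ext_d1E _ _ dv).
ring.
Qed.

Lemma ext_d2Z (F : realType) (f : 'rV[F]_3 -> F) (W : 'rV[F]_3 -> 'M[F]_3)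
    (x : 'rV[F]_3) :
  differentiable f x -> (forall k l, differentiable (fun y => W y k l) x) ->
  ext_d2 (fun y => f y *: W y) x = wedge21 (W x) (grad f x) + f x * ext_d2 W x.
Proof.
move=> df dW.
have e k l : (fun y => (f y *: W y) k l) = (fun y => f y * W y k l).
  by apply/funext => y; rewrite mxE.
rewrite /ext_d2 !e !(derive_mul _ df (dW _ _)) /wedge21 !gradE.
ring.
Qed.

Lemma ext_d2D (F : realType) (W Z : 'rV[F]_3 -> 'M[F]_3) (x : 'rV[F]_3) :
  (forall k l, differentiable (fun y => W y k l) x) ->
  (forall k l, differentiable (fun y => Z y k l) x) ->
  ext_d2 (fun y => W y + Z y) x = ext_d2 W x + ext_d2 Z x.
Proof.
move=> dW dZ.
have e k l : (fun y => (W y + Z y) k l) = (fun y => W y k l + Z y k l).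
  by apply/funext => y; rewrite mxE.
rewrite /ext_d2 !e !(derive_add _ (dW _ _) (dZ _ _)).
ring.
Qed.

Lemma wedge11_differentiable (F : realType) (u v : 'rV[F]_3 -> 'cV[F]_3)
    (x : 'rV[F]_3) k l :
  form_differentiable u x -> form_differentiable v x ->
  differentiable (fun y => wedge11 (u y) (v y) k l) x.
Proof.
move=> du dv.
have -> : (fun y => wedge11 (u y) (v y) k l) =
    ((fun y => u y k ord0) * (fun y => v y l ord0)) \-
    ((fun y => u y l ord0) * (fun y => v y k ord0)).
  by apply/funext => y; rewrite mxE.
exact: differentiableB (differentiableM (du k) (dv l))
                       (differentiableM (du l) (dv k)).
Qed.

Lemma near_eq_differentiable (F : realType) (V W : normedModType F)
    (f g : V -> W) (x : V) :
  (\forall y \near x, f y = g y) -> differentiable f x -> differentiable g x.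
Proof.
move=> fg /diff_locallyP [cd df].
have fgx : f x = g x := nbhs_singleton fg.
have dg : g \o shift x = cst (g x) + 'd f x +o_ (0 : V) id.
  apply/eqaddoP => e e0; have := (iffLR (eqaddoP _ _ _ _) df) e e0.
  have fg0 : \forall h \near (0 : V), f (h + x) = g (h + x).
    by move: fg; rewrite (near_shift 0 x) /= subr0.
  move=> H; apply: filterS (filterI fg0 H) => h [E].
  rewrite -[X in `|X|]/(f (h + x) - (f x + 'd f x h)) E fgx.
  by [].
by apply/diff_locallyP; rewrite (diff_unique cd dg).
Qed.

(** Near [x] the function is the quotient of two components, chosen so that the
    denominator does not vanish.  Coefficients in a coframe are differentiated
    in this way. *)
Lemma quotient_differentiable (F : realType) (f : 'rV[F]_3 -> F)
    (u g : 'rV[F]_3 -> 'cV[F]_3) (x : 'rV[F]_3) :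
  (\forall y \near x, f y *: u y = g y) -> u x != 0 ->
  form_differentiable u x -> form_differentiable g x -> differentiable f x.
Proof.
move=> fug ux0 du dg.
have [l ul0] : exists l, u x l ord0 != 0.
  apply/existsP; apply: contraNT ux0; rewrite negb_exists => /forallP u0.
  by apply/eqP/colP => l; rewrite mxE; apply/eqP; rewrite -[_ == _]negbK.
apply: (@near_eq_differentiable F _ _
  ((fun y => g y l ord0) * (fun y => (u y l ord0)^-1))); last first.
  exact: differentiableM (dg l) (differentiableV (du l) ul0).
have cu := differentiable_continuous (du l).
have nu : \forall y \near x, u y l ord0 != 0.
  exact: cvgr_neq0 cu ul0.
apply: filterS (filterI fug nu) => y [e uy0].
by rewrite /GRing.mul /= -e scalemxE mulfK.
Qed.

(** * Linear algebra of coframes *)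

Lemma ord3P (j : 'I_3) : [\/ j = ix1, j = ix2 | j = ix3].
Proof.
by case: j => [[|[|[|//]]] hj]; [apply: Or31|apply: Or32|apply: Or33];
   apply: val_inj.
Qed.

Definition independent (F : realType) (a1 a2 a3 : 'cV[F]_3) : Prop :=
  forall c1 c2 c3, c1 *: a1 + c2 *: a2 + c3 *: a3 = 0 ->
    [/\ c1 = 0, c2 = 0 & c3 = 0].

Lemma independent_neq0 (F : realType) (a1 a2 a3 : 'cV[F]_3) :
  independent a1 a2 a3 -> a1 != 0.
Proof.
move=> ind; apply/eqP => a0; have [] := ind 1 0 0.
  by rewrite a0 scaler0 !scale0r !addr0.
by move/eqP; rewrite oner_eq0.
Qed.

Lemma independent_span (F : realType) (a1 a2 a3 v : 'cV[F]_3) :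
  independent a1 a2 a3 ->
  exists c1 c2 c3, v = c1 *: a1 + c2 *: a2 + c3 *: a3.
Proof.
move=> ind; pose N : 'M[F]_3 := \matrix_(k < 3) [:: a1^T; a2^T; a3^T]`_k.
have mulN (c : 'rV[F]_3) :
    c *m N = (c ord0 ix1 *: a1 + c ord0 ix2 *: a2 + c ord0 ix3 *: a3)^T.
  rewrite mulmx_sum_row !big_ord_recl big_ord0 addr0 addrA !rowK /=.
  rewrite !linearD !linearZ /=.
  by congr (c _ _ *: _ + c _ _ *: _ + c _ _ *: _); apply: val_inj.
have uN : N \in unitmx.
  rewrite unitmxE unitfE; apply/negP => /det0P [c c0 cN].
  have := mulN c; rewrite cN => /(congr1 trmx); rewrite trmx0 trmxK => /esym.
  move=> /ind [e1 e2 e3]; case/eqP: c0; apply/rowP => j; rewrite mxE.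
  case: j => [[|[|[|//]]] h];
  [rewrite -[RHS]e1|rewrite -[RHS]e2|rewrite -[RHS]e3];
  by congr (c _ _); apply: val_inj.
pose c := v^T *m invmx N.
exists (c ord0 ix1), (c ord0 ix2), (c ord0 ix3).
by rewrite -[RHS]trmxK -mulN /c mulmxKV // trmxK.
Qed.

Lemma independent_eq (F : realType) (a1 a2 a3 : 'cV[F]_3) c1 c2 c3 d1 d2 d3 :
  independent a1 a2 a3 ->
  c1 *: a1 + c2 *: a2 + c3 *: a3 = d1 *: a1 + d2 *: a2 + d3 *: a3 ->
  [/\ c1 = d1, c2 = d2 & c3 = d3].
Proof.
move=> ind e.
move/eqP: e; rewrite -subr_eq0 => /eqP e.
have [] := ind (c1 - d1) (c2 - d2) (c3 - d3).
  by rewrite -[RHS]e; apply/colP => k; rewrite !mxE; ring.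
by move=> /subr0_eq -> /subr0_eq -> /subr0_eq ->.
Qed.

(** Each row of the 2-form is a combination of the covectors themselves, whose
    coefficients, linear in the components of [a1], [a2], [a3], must vanish. *)
Lemma independent_wedges (F : realType) (a1 a2 a3 : 'cV[F]_3) x12 x13 x23 :
  independent a1 a2 a3 ->
  x12 *: wedge11 a1 a2 + x13 *: wedge11 a1 a3 + x23 *: wedge11 a2 a3 = 0 ->
  [/\ x12 = 0, x13 = 0 & x23 = 0].
Proof.
move=> ind e.
have r k : [/\ - (x12 * a2 k ord0 + x13 * a3 k ord0) = 0,
   x12 * a1 k ord0 - x23 * a3 k ord0 = 0 &
   x13 * a1 k ord0 + x23 * a2 k ord0 = 0].
  apply: ind; apply/colP => l; have := congr1 (fun M : 'M[F]_3 => M k l) e.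
  by rewrite !mxE => <-; ring.
(* the coefficients of a1 in the rows form x12 a2 + x13 a3 up to sign, those of
   a3 form x13 a1 + x23 a2 *)
have [_ -> ->] : [/\ 0 = 0 :> F, x12 = 0 & x13 = 0].
  apply: ind; apply/colP => k; have [e1 _ _] := r k.
  by rewrite !mxE -[RHS]oppr0 -[in RHS]e1; ring.
have [_ -> _] : [/\ x13 = 0, x23 = 0 & 0 = 0 :> F]; last by [].
apply: ind; apply/colP => k; have [_ _ e3] := r k.
by rewrite !mxE -[RHS]e3; ring.
Qed.

(** If the triple product vanished, so would the wedge of a1/\a2 with every
    covector, and a1/\a2 itself. *)
Lemma triple_neq0 (F : realType) (a1 a2 a3 : 'cV[F]_3) :
  independent a1 a2 a3 -> wedge21 (wedge11 a1 a2) a3 != 0.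
Proof.
move=> ind; apply/negP => /eqP t0.
have all0 v : wedge21 (wedge11 a1 a2) v = 0.
  have [c1 [c2 [c3 ->]]] := independent_span v ind.
  rewrite -[RHS](mulr0 c3) -t0 /wedge21 !mxE; ring.
have := independent_wedges (x12 := 1) (x13 := 0) (x23 := 0) ind.
case; last by move/eqP; rewrite oner_eq0.
have := (all0 (delta_mx ix1 0), all0 (delta_mx ix2 0), all0 (delta_mx ix3 0)).
rewrite /wedge21 ![delta_mx _ _ _ _]mxE /= !mulr0 !mulr1 !addr0 !add0r.
move=> [[e23 e31] e12].
rewrite !scale0r scale1r !addr0; apply/matrixP => k l.
have anti i j : wedge11 a1 a2 i j = - wedge11 a1 a2 j i by rewrite !mxE; ring.
have diag i : wedge11 a1 a2 i i = 0 by rewrite mxE; ring.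
rewrite [RHS]mxE; have [->|->|->] := ord3P k; have [->|->|->] := ord3P l;
  by rewrite ?diag ?e23 ?e31 ?e12 // anti ?e23 ?e31 ?e12 oppr0.
Qed.

(** The equation is d(a1) = d(m w2) with dw2 = - w1/\w3, where
    w1 = p a1 + q a3 and w3 = a2. *)
Lemma first_order_coefficients (F : realType) (a1 a2 a3 w2 : 'cV[F]_3)
    (m m1 m2 m3 p q : F) :
  independent a1 a2 a3 -> m != 0 -> a1 = m *: w2 ->
  wedge11 a2 a3 =
    wedge11 (m1 *: a1 + m2 *: a2 + m3 *: a3) w2 +
    m *: (- wedge11 (p *: a1 + q *: a3) a2) ->
  [/\ m3 = 0, q = m^-1 & p = - (m2 / m ^+ 2)].
Proof.
move=> ind m0 e1 e.
have e2 : w2 = m^-1 *: a1 by rewrite e1 scalerA mulVf // scale1r.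
rewrite e2 in e.
have [] := independent_wedges (x12 := m2 / m + m * p) (x13 := m3 / m)
  (x23 := 1 - m * q) ind.
  move/eqP: e; rewrite -subr_eq0 => /eqP e; rewrite -[RHS]e.
  by apply/matrixP => k l; rewrite !mxE; ring.
move=> h12 /eqP; rewrite mulf_eq0 invr_eq0 (negPf m0) orbF => /eqP -> h23.
split=> //.
  by apply: (mulfI m0); rewrite mulfV //; apply/esym/subr0_eq.
apply: (mulfI m0); move/eqP: h12; rewrite addrC addr_eq0 => /eqP ->.
by field.
Qed.

(** The equation is the structure equation of w1 = p a1 + q a3, where w2 = q a1
    and w3 = a2; [p1], ..., [q3] are the coefficients of dp and dq. *)
Lemma second_order_coefficients (F : realType) (a1 a2 a3 : 'cV[F]_3)
    (p p1 p2 p3 q q1 q2 q3 R I : F) :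
  independent a1 a2 a3 ->
  wedge11 (p1 *: a1 + p2 *: a2 + p3 *: a3) a1 + p *: wedge11 a2 a3 +
    (wedge11 (q1 *: a1 + q2 *: a2 + q3 *: a3) a3 + q *: (R *: wedge11 a1 a2)) =
  - I *: wedge11 (p *: a1 + q *: a3) a2 + wedge11 (q *: a1) a2 ->
  [/\ q * R - p2 = q - I * p & p + q2 = I * q].
Proof.
move=> ind e.
have [] := independent_wedges (x12 := q * R - p2 - (q - I * p))
  (x13 := q1 - p3) (x23 := p + q2 - I * q) ind.
  move/eqP: e; rewrite -subr_eq0 => /eqP e; rewrite -[RHS]e.
  by apply/matrixP => k l; rewrite !mxE; ring.
by move=> /subr0_eq -> _ /subr0_eq ->.
Qed.

(** The equation is d(dm) = 0 for dm = m1 a1 + m2 a2. *)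
Lemma hessian_coefficients (F : realType) (a1 a2 a3 : 'cV[F]_3)
    (m1 m2 m11 m12 m13 m21 m22 m23 : F) :
  independent a1 a2 a3 ->
  wedge11 (m11 *: a1 + m12 *: a2 + m13 *: a3) a1 + m1 *: wedge11 a2 a3 +
    (wedge11 (m21 *: a1 + m22 *: a2 + m23 *: a3) a2 +
     m2 *: - wedge11 a1 a3) = 0 ->
  m12 = m21 /\ m23 = m1.
Proof.
move=> ind e.
have [] := independent_wedges (x12 := m21 - m12) (x13 := - m13 - m2)
  (x23 := m1 - m23) ind.
  by rewrite -[RHS]e; apply/matrixP => k l; rewrite !mxE; ring.
by move=> /subr0_eq -> _ /subr0_eq ->.
Qed.

Lemma bianchi_coefficients (F : realType) (a1 a2 a3 : 'cV[F]_3)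
    (p q I1 I2 I3 : F) :
  independent a1 a2 a3 ->
  wedge21 (wedge11 (p *: a1 + q *: a3) a2)
    (I1 *: a1 + I2 *: a2 + I3 *: a3) = 0 ->
  p * I3 = q * I1.
Proof.
move=> ind e; apply/subr0_eq/(mulIf (triple_neq0 ind)).
by rewrite mul0r -[RHS]e /wedge21 !mxE; ring.
Qed.

(** * The structure equations in a chart *)

(** The identity d(d w1) = 0.  In d(- I w1/\w3 + w2/\w3) the terms that do not
    contain dI vanish by the structure equations: each repeats a factor. *)
Lemma landsberg_bianchi (F : realType) (U : set 'rV[F]_3) (I K : 'rV[F]_3 -> F)
    (w1 w2 w3 : 'rV[F]_3 -> 'cV[F]_3) (x : 'rV[F]_3) :
  open U -> U x -> differentiable I x -> smooth_on U w1 ->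
  form_differentiable w2 x -> form_differentiable w3 x ->
  (forall y, U y -> ext_d1 w1 y =
     - I y *: wedge11 (w1 y) (w3 y) + wedge11 (w2 y) (w3 y)) ->
  ext_d1 w2 x = - wedge11 (w1 x) (w3 x) ->
  ext_d1 w3 x = K x *: wedge11 (w1 x) (w2 x) ->
  wedge21 (wedge11 (w1 x) (w3 x)) (grad I x) = 0.
Proof.
move=> oU Ux dI sw1 dw2 dw3 c1 c2 c3.
have dw1 := smooth_form_differentiable oU sw1 Ux.
have dNI : differentiable (fun y => - I y) x by exact: differentiableN dI.
have d13 k l := wedge11_differentiable k l dw1 dw3.
have d23 k l := wedge11_differentiable k l dw2 dw3.
have := ext_d2_ext_d1 oU sw1 Ux.
rewrite (@near_eq_ext_d2 _ _ (fun y => - I y *: wedge11 (w1 y) (w3 y) +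
                           wedge11 (w2 y) (w3 y))); last first.
  by apply: filterS (open_nbhs_nbhs (conj oU Ux)) => y; exact: c1.
rewrite ext_d2D //; last first.
  move=> k l; have -> : (fun y => (- I y *: wedge11 (w1 y) (w3 y)) k l) =
     (fun y => - I y) * (fun y => wedge11 (w1 y) (w3 y) k l).
    by apply/funext => y; rewrite scalemxE.
  exact: differentiableM dNI (d13 k l).
rewrite (ext_d2Z dNI d13) (ext_d2_wedge11 dw1 dw3) (ext_d2_wedge11 dw2 dw3).
have -> : grad (fun y => - I y) x = - grad I x.
  apply/colP => k; rewrite gradE [RHS]mxE gradE.
  exact: deriveN (diff_derivable dI).
rewrite (c1 x Ux) c2 c3 => e; rewrite -[RHS]oppr0 -[in RHS]e.
move: (grad I x) (w1 x) (w2 x) (w3 x) (I x) (K x) => g u1 u2 u3 i k.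
by rewrite /wedge21 !mxE; ring.
Qed.

(** Both structures in one chart, under the two conditions; [m1], [m2], [m3] are
    the coefficients of dm in the first coframe. *)
Record identified_pair (F : realType) (U : set 'rV[F]_3)
    (a1 a2 a3 w1 w2 w3 : 'rV[F]_3 -> 'cV[F]_3)
    (R I K m m1 m2 m3 : 'rV[F]_3 -> F) : Prop := IdentifiedPair {
  pair_open : open U;
  pair_smooth_a1 : smooth_on U a1;
  pair_smooth_a2 : smooth_on U a2;
  pair_smooth_a3 : smooth_on U a3;
  pair_smooth_w1 : smooth_on U w1;
  pair_smooth_w2 : smooth_on U w2;
  pair_smooth_w3 : smooth_on U w3;
  pair_smooth_I : smooth_on U I;
  pair_smooth_m : smooth_on U m;
  pair_independent : forall x, U x -> independent (a1 x) (a2 x) (a3 x);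
  pair_m_neq0 : forall x, U x -> m x != 0;
  pair_ext_d_a1 : forall x, U x -> ext_d1 a1 x = wedge11 (a2 x) (a3 x);
  pair_ext_d_a2 : forall x, U x -> ext_d1 a2 x = - wedge11 (a1 x) (a3 x);
  pair_ext_d_a3 : forall x, U x -> ext_d1 a3 x = R x *: wedge11 (a1 x) (a2 x);
  pair_ext_d_w1 : forall x, U x -> ext_d1 w1 x =
    - I x *: wedge11 (w1 x) (w3 x) + wedge11 (w2 x) (w3 x);
  pair_ext_d_w2 : forall x, U x -> ext_d1 w2 x = - wedge11 (w1 x) (w3 x);
  pair_ext_d_w3 : forall x, U x -> ext_d1 w3 x = K x *: wedge11 (w1 x) (w2 x);
  pair_a1E : forall x, U x -> a1 x = m x *: w2 x;
  pair_a2E : forall x, U x -> a2 x = w3 x;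
  pair_w1_span : forall x, U x -> exists p q, w1 x = p *: a1 x + q *: a3 x;
  pair_grad_m : forall x, U x ->
    grad m x = m1 x *: a1 x + m2 x *: a2 x + m3 x *: a3 x
}.

Lemma pair_first_order (F : realType) (U : set 'rV[F]_3)
    (a1 a2 a3 w1 w2 w3 : 'rV[F]_3 -> 'cV[F]_3)
    (R I K m m1 m2 m3 : 'rV[F]_3 -> F) (x : 'rV[F]_3) :
  identified_pair U a1 a2 a3 w1 w2 w3 R I K m m1 m2 m3 -> U x ->
  m3 x = 0 /\ w1 x = - (m2 x / m x ^+ 2) *: a1 x + (m x)^-1 *: a3 x.
Proof.
move=> P Ux; have oU := pair_open P.
have [p [q e1]] := pair_w1_span P Ux.
have [] := first_order_coefficients (m1 := m1 x) (m2 := m2 x) (m3 := m3 x)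
  (p := p) (q := q) (pair_independent P Ux) (pair_m_neq0 P Ux) (pair_a1E P Ux).
  rewrite -(pair_ext_d_a1 P Ux) -(pair_grad_m P Ux) -e1 (pair_a2E P Ux).
  rewrite -(pair_ext_d_w2 P Ux) -ext_d1Z.
  - by apply: near_eq_ext_d1; apply: filterS (open_nbhs_nbhs (conj oU Ux)) => y;
       exact: pair_a1E P _.
  - exact: smooth_differentiable oU (pair_smooth_m P) Ux.
  - exact: smooth_form_differentiable oU (pair_smooth_w2 P) Ux.
by move=> m30 <- <-.
Qed.

(** Each coefficient inherits its regularity from smooth forms, as a quotient
    of components: p = - m2/m^2 from w1 = p a1 + a3/m, which settles [m2], and
    then [m1] from dm = m1 a1 + m2 a2. *)
Lemma pair_differentiable (F : realType) (U : set 'rV[F]_3)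
    (a1 a2 a3 w1 w2 w3 : 'rV[F]_3 -> 'cV[F]_3)
    (R I K m m1 m2 m3 : 'rV[F]_3 -> F) (x : 'rV[F]_3) :
  identified_pair U a1 a2 a3 w1 w2 w3 R I K m m1 m2 m3 -> U x ->
  [/\ differentiable (fun y => - (m2 y / m y ^+ 2)) x,
      differentiable m1 x & differentiable m2 x].
Proof.
move=> P Ux; have oU := pair_open P.
have nU := open_nbhs_nbhs (conj oU Ux).
have dm := smooth_differentiable oU (pair_smooth_m P) Ux.
have da1 := smooth_form_differentiable oU (pair_smooth_a1 P) Ux.
have da2 := smooth_form_differentiable oU (pair_smooth_a2 P) Ux.
have da3 := smooth_form_differentiable oU (pair_smooth_a3 P) Ux.
have dw1 := smooth_form_differentiable oU (pair_smooth_w1 P) Ux.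
have a10 := independent_neq0 (pair_independent P Ux).
have dV : differentiable (fun y => - (m y)^-1) x.
  exact: differentiableN (differentiableV dm (pair_m_neq0 P Ux)).
have dp : differentiable (fun y => - (m2 y / m y ^+ 2)) x.
  apply: (quotient_differentiable _ a10 da1
            (form_differentiableD dw1 (form_differentiableZ dV da3))).
  apply: filterS nU => y Uy; have [_ ->] := pair_first_order P Uy.
  by rewrite (scaleNr (m y)^-1) addrK.
have dm2 : differentiable m2 x.
  have dmm : differentiable (fun y => - (m y * m y)) x.
    exact: differentiableN (differentiableM dm dm).
  apply: near_eq_differentiable (differentiableM dp dmm).
  apply: filterS nU => y Uy; have m0 := pair_m_neq0 P Uy.
  by rewrite /GRing.mul /= -[LHS]/(- (m2 y / m y ^+ 2) * - (m y * m y)); field.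
split=> //.
have dNm2 : differentiable (fun y => - m2 y) x by exact: differentiableN dm2.
apply: (quotient_differentiable _ a10 da1 (form_differentiableD
         (grad_differentiable oU (pair_smooth_m P) Ux)
         (form_differentiableZ dNm2 da2))).
apply: filterS nU => y Uy; rewrite (pair_grad_m P Uy).
have [-> _] := pair_first_order P Uy.
by rewrite scale0r addr0 (scaleNr (m2 y)) addrK.
Qed.

Lemma pair_second_order (F : realType) (U : set 'rV[F]_3)
    (a1 a2 a3 w1 w2 w3 : 'rV[F]_3 -> 'cV[F]_3)
    (R I K m m1 m2 m3 : 'rV[F]_3 -> F) (x : 'rV[F]_3) (d1 d2 d3 : F) :
  identified_pair U a1 a2 a3 w1 w2 w3 R I K m m1 m2 m3 -> U x ->
  grad m2 x = d1 *: a1 x + d2 *: a2 x + d3 *: a3 x ->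
  I x = - 2 * (m2 x / m x) /\ R x = 1 - d2 / m x.
Proof.
move=> P Ux gm2; have oU := pair_open P.
have nU := open_nbhs_nbhs (conj oU Ux).
have ind := pair_independent P Ux.
have m0 := pair_m_neq0 P Ux.
have dm := smooth_differentiable oU (pair_smooth_m P) Ux.
have da1 := smooth_form_differentiable oU (pair_smooth_a1 P) Ux.
have da3 := smooth_form_differentiable oU (pair_smooth_a3 P) Ux.
have [dp _ dm2] := pair_differentiable P Ux.
set p := fun y => - (m2 y / m y ^+ 2) in dp.
pose q y := (m y)^-1.
have dq : differentiable q x by exact: differentiableV dm m0.
have [p1 [p2 [p3 gp]]] := independent_span (grad p x) ind.
have [q1 [q2 [q3 gq]]] := independent_span (grad q x) ind.
have [m30 w1x] := pair_first_order P Ux.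
have gm : grad m x = m1 x *: a1 x + m2 x *: a2 x + 0 *: a3 x.
  by rewrite (pair_grad_m P Ux) m30.
(* dq follows from m q = 1 *)
have [_ eq2 _] : [/\ m x * q1 + q x * m1 x = 0, m x * q2 + q x * m2 x = 0 &
    m x * q3 + q x * 0 = 0].
  apply: ind; have : grad (fun y => m y * q y) x = grad (cst 1) x.
    apply: near_eq_grad; apply: filterS nU => y Uy.
    by rewrite /q mulfV // (pair_m_neq0 P Uy).
  have -> : grad (cst (1 : F)) x = 0.
    by apply/colP => k; rewrite gradE derive_cst mxE.
  rewrite (gradM dm dq) gm gq => <-.
  by apply/colP => k; rewrite !mxE; ring.
(* the relation between dm2 and dp follows from m2 = - p m^2 *)
have [_ ed2 _] : [/\ d1 = - (m x * (m x * p1 + p x * m1 x) + m x * p x * m1 x),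
    d2 = - (m x * (m x * p2 + p x * m2 x) + m x * p x * m2 x) &
    d3 = - (m x * (m x * p3 + p x * 0) + m x * p x * 0)].
  apply: independent_eq ind _; rewrite -gm2.
  pose mp y := m y * p y.
  have dmp : differentiable mp x by exact: differentiableM dm dp.
  pose Nm y := - m y.
  have dNm : differentiable Nm x by exact: differentiableN dm.
  have gNm : grad Nm x = - grad m x.
    apply/colP => k; rewrite gradE [RHS]mxE gradE.
    exact: deriveN (diff_derivable dm).
  have -> : grad m2 x = grad (fun y => Nm y * mp y) x.
    apply: near_eq_grad; apply: filterS nU => y Uy.
    by rewrite /Nm /mp /p; have := pair_m_neq0 P Uy; move=> my0; field.
  rewrite (gradM dNm dmp) (gradM dm dp) gNm gm gp /Nm /mp.
  by apply/colP => k; rewrite !mxE; ring.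
have [eR eI] : q x * R x - p2 = q x - I x * p x /\ p x + q2 = I x * q x.
  apply: (second_order_coefficients (p1 := p1) (p3 := p3)
            (q1 := q1) (q3 := q3) ind).
  rewrite -gp -gq -(pair_ext_d_a1 P Ux) -(pair_ext_d_a3 P Ux).
  rewrite -(ext_d1Z dp da1) -(ext_d1Z dq da3).
  rewrite -(ext_d1D (form_differentiableZ dp da1)
                  (form_differentiableZ dq da3)).
  have -> : q x *: a1 x = w2 x.
    by rewrite (pair_a1E P Ux) scalerA mulVf // scale1r.
  rewrite -w1x (pair_a2E P Ux) -(pair_ext_d_w1 P Ux).
  apply: near_eq_ext_d1; apply: filterS nU => y Uy.
  by have [_ ->] := pair_first_order P Uy.
have e2 : q2 = - (m2 x / m x ^+ 2).
  apply: (mulfI m0); move/eqP: eq2; rewrite addr_eq0 => /eqP ->.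
  by rewrite /q; field.
have IE : I x = - 2 * (m2 x / m x).
  have qx0 : q x != 0 by rewrite invr_neq0.
  by apply: (mulIf qx0); rewrite -eI e2 /p /q; field.
split=> //; have qx0 : q x != 0 by rewrite invr_neq0.
apply: (mulfI qx0); move/eqP: eR; rewrite subr_eq => /eqP ->.
by rewrite ed2 IE /p /q; field.
Qed.

Lemma pair_m12_eq0 (F : realType) (U : set 'rV[F]_3)
    (a1 a2 a3 w1 w2 w3 : 'rV[F]_3 -> 'cV[F]_3)
    (R I K m m1 m2 m3 : 'rV[F]_3 -> F) (x : 'rV[F]_3) (c1 c2 c3 : F) :
  identified_pair U a1 a2 a3 w1 w2 w3 R I K m m1 m2 m3 -> U x ->
  grad m1 x = c1 *: a1 x + c2 *: a2 x + c3 *: a3 x -> c2 = 0.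
Proof.
move=> P Ux gm1; have oU := pair_open P.
have nU := open_nbhs_nbhs (conj oU Ux).
have ind := pair_independent P Ux.
have m0 := pair_m_neq0 P Ux.
have dm := smooth_differentiable oU (pair_smooth_m P) Ux.
have dI := smooth_differentiable oU (pair_smooth_I P) Ux.
have da1 := smooth_form_differentiable oU (pair_smooth_a1 P) Ux.
have da2 := smooth_form_differentiable oU (pair_smooth_a2 P) Ux.
have dw2 := smooth_form_differentiable oU (pair_smooth_w2 P) Ux.
have dw3 := smooth_form_differentiable oU (pair_smooth_w3 P) Ux.
have [_ dm1 dm2] := pair_differentiable P Ux.
have [d1 [d2 [d3 gm2]]] := independent_span (grad m2 x) ind.
have [I1 [I2 [I3 gI]]] := independent_span (grad I x) ind.
have [m30 w1x] := pair_first_order P Ux.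
have gm : grad m x = m1 x *: a1 x + m2 x *: a2 x + 0 *: a3 x.
  by rewrite (pair_grad_m P Ux) m30.
have IE y : U y -> I y = - 2 * (m2 y / m y).
  move=> Uy; have indy := pair_independent P Uy.
  have [e1 [e2 [e3 ge]]] := independent_span (grad m2 y) indy.
  by have [] := pair_second_order P Uy ge.
have [c2d1 d3m1] : c2 = d1 /\ d3 = m1 x.
  apply: (hessian_coefficients (m11 := c1) (m13 := c3)
            (m2 := m2 x) (m22 := d2) ind).
  rewrite -gm1 -gm2 -(pair_ext_d_a1 P Ux) -(pair_ext_d_a2 P Ux).
  rewrite -(ext_d1Z dm1 da1) -(ext_d1Z dm2 da2).
  rewrite -(ext_d1D (form_differentiableZ dm1 da1)
                  (form_differentiableZ dm2 da2)).
  rewrite -(ext_d1_grad oU (pair_smooth_m P) Ux).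
  apply: near_eq_ext_d1; apply: filterS nU => y Uy.
  rewrite (pair_grad_m P Uy); have [-> _] := pair_first_order P Uy.
  by rewrite scale0r addr0.
have [e1 _ e3] : [/\ I x * m1 x + m x * I1 = - 2 * d1,
    I x * m2 x + m x * I2 = - 2 * d2 & I x * 0 + m x * I3 = - 2 * d3].
  apply: independent_eq ind _.
  have : grad (fun y => I y * m y) x = grad (fun y => cst (- 2) y * m2 y) x.
    apply: near_eq_grad; apply: filterS nU => y Uy.
    by rewrite (IE y Uy) -mulrA divfK // (pair_m_neq0 P Uy).
  rewrite (gradM dI dm) (gradM (differentiable_cst (- 2 : F) x) dm2).
  have -> : grad (cst (- 2 : F)) x = 0.
    by apply/colP => k; rewrite gradE derive_cst mxE.
  rewrite gm gI gm2 scaler0 addr0 /cst => e.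
  transitivity (- 2 *: (d1 *: a1 x + d2 *: a2 x + d3 *: a3 x)).
    by rewrite -e; apply/colP => k; rewrite !mxE; ring.
  by apply/colP => k; rewrite !mxE; ring.
have eB : - (m2 x / m x ^+ 2) * I3 = (m x)^-1 * I1.
  apply: (bianchi_coefficients (I2 := I2) ind).
  rewrite -w1x -gI (pair_a2E P Ux).
  have dw1 y (Uy : U y) := pair_ext_d_w1 P Uy.
  exact: (landsberg_bianchi oU Ux dI (pair_smooth_w1 P) dw2 dw3 dw1
            (pair_ext_d_w2 P Ux) (pair_ext_d_w3 P Ux)).
rewrite c2d1; move: e1 e3 eB; rewrite (IE x Ux) mulr0 add0r d3m1 => e1 e3 eB.
have I1E : I1 = - (m2 x / m x) * I3.
  by apply: (mulfI (invr_neq0 m0)); rewrite -eB; field.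
rewrite I1E in e1.
have : - 2 * d1 = - (m2 x / m x) * (m x * I3 + 2 * m1 x) by rewrite -e1; ring.
by rewrite e3; lra.
Qed.

(** * Covectors and directional derivatives on the manifold *)

Lemma components_comb (F : realType) (M : manifold3 F) (p : M)
    (c : 'I_3 -> F) (b : 'I_3 -> cotangent p) (i : chart_index M) :
  (\sum_(k < 3) c k *: b k) i =
  c ix1 *: b ix1 i + c ix2 *: b ix2 i + c ix3 *: b ix3 i.
Proof.
rewrite !big_ord_recl big_ord0 addr0.
have e0 : ord0 = ix1 by apply: val_inj.
have e1 : lift ord0 ord0 = ix2 by apply: val_inj.
have e2 : lift ord0 (lift ord0 ord0) = ix3 by apply: val_inj.
by rewrite e2 e1 e0 -addrA.
Qed.

(** The transformation law determines the components in the other charts. *)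
Lemma cotangent_eq (F : realType) (M : manifold3 F) (p : M)
    (b b' : cotangent p) (i : chart_index M) :
  chart_dom i p -> b i = b' i -> b = b'.
Proof.
move=> hi e; apply: val_inj; apply/funext => j.
have /asboolP [cb cb0] := components_covariant b.
have /asboolP [cb' cb0'] := components_covariant b'.
have [hj|hj] := pselect (chart_dom j p); last first.
  by rewrite /= (cb0 j hj) (cb0' j hj).
by rewrite /= (cb j i hj hi) (cb' j i hj hi) e.
Qed.

Definition fun3 (T : Type) (x1 x2 x3 : T) (j : 'I_3) : T :=
  nth x3 [:: x1; x2] j.

Lemma coframing_independent (F : realType) (M : manifold3 F)
    (a : covector_triple M) (p : M) (i : chart_index M) :
  coframing a -> chart_dom i p ->
  independent (a ix1 p i) (a ix2 p i) (a ix3 p i).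
Proof.
move=> [_ fa] hi c1 c2 c3 e.
have f0 := fa p (fun3 c1 c2 c3).
have {}f0 : forall j, fun3 c1 c2 c3 j = 0.
  apply: f0; apply: (cotangent_eq hi).
  by rewrite (components_comb _ (fun j => a j p)) e.
by split; [exact: (f0 ix1)|exact: (f0 ix2)|exact: (f0 ix3)].
Qed.

Lemma coframing_coords (F : realType) (M : manifold3 F)
    (a : covector_triple M) (p : M) (b : cotangent p) :
  coframing a -> exists c : 'I_3 -> F, b = \sum_(k < 3) c k *: a k p.
Proof.
move=> fa; have [i hi] := chart_dom_cover p.
have [c1 [c2 [c3 e]]] := independent_span (b i) (coframing_independent fa hi).
exists (fun3 c1 c2 c3); apply: (cotangent_eq hi).
by rewrite (components_comb _ (fun j => a j p)).
Qed.

Lemma coframing_coords_inj (F : realType) (M : manifold3 F)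
    (a : covector_triple M) (p : M) (c d : 'I_3 -> F) :
  coframing a ->
  \sum_(k < 3) c k *: a k p = \sum_(k < 3) d k *: a k p -> c =1 d.
Proof.
move=> [_ fa] e j; apply/subr0_eq; apply: (fa p (fun k => c k - d k)).
transitivity (\sum_(k < 3) c k *: a k p - \sum_(k < 3) d k *: a k p).
  by rewrite -sumrB; apply: eq_bigr => k _; rewrite scalerBl.
by rewrite e subrr.
Qed.

(** The map sends a covector with coordinates [c] in [a] to the one with the
    same coordinates in [w]. *)
Lemma coframing_endo (F : realType) (M : manifold3 F)
    (a w : covector_triple M) :
  coframing a -> exists A : cotangent_endo M, maps_coframing A a w.
Proof.
move=> fa.
pose co p (b : cotangent p) := sval (cid (coframing_coords b fa)).
have coE p (b : cotangent p) : b = \sum_(k < 3) co p b k *: a k p.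
  by rewrite /co; case: cid.
pose A p (b : cotangent p) : cotangent p := \sum_(k < 3) co p b k *: w k p.
have linA p : linear (A p).
  move=> r b b'.
  have e : co p (r *: b + b') =1 (fun k => r * co p b k + co p b' k).
    apply: (coframing_coords_inj (p := p) fa); rewrite -coE.
    rewrite {1}(coE p b) {1}(coE p b').
    rewrite scaler_sumr -big_split; apply: eq_bigr => k _ /=.
    by rewrite scalerA -scalerDl.
  rewrite /A scaler_sumr -big_split; apply: eq_bigr => k _ /=.
  by rewrite e scalerDl scalerA.
pose mixin p :=
  GRing.isLinear.Build F (cotangent p) (cotangent p) *:%R (A p) (linA p).
pose L p : {linear cotangent p -> cotangent p} := HB.pack (A p) (mixin p).
exists L => j p; rewrite -[RHS]/(A p (a j p)).
have e : co p (a j p) =1 (fun k => (k == j)%:R).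
  apply: (coframing_coords_inj (p := p) fa); rewrite -coE.
  rewrite (bigD1 j) //= eqxx scale1r big1 ?addr0 // => k /negPf ->.
  by rewrite scale0r.
rewrite /A (bigD1 j) //= e eqxx scale1r big1 ?addr0 // => k /negPf kj.
by rewrite e kj scale0r.
Qed.

Lemma maps_coframing_unique (F : realType) (M : manifold3 F)
    (a w : covector_triple M) (A B : cotangent_endo M) :
  coframing a -> maps_coframing A a w -> maps_coframing B a w ->
  forall p, B p =1 A p.
Proof.
move=> fa mA mB p b; have [c ->] := coframing_coords b fa.
by rewrite !linear_sum; apply: eq_bigr => k _; rewrite !linearZ -mA -mB.
Qed.

Lemma differential_transition (F : realType) (M : manifold3 F) (f : M -> F)
    (i j : chart_index M) (p : M) :
  chart_dom i p -> chart_dom j p ->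
  differentiable (f \o chart_inv i) (chart i p) ->
  differential f j p = transition_jacobian j i p *m differential f i p.
Proof.
move=> hi hj df; apply/colP => k; rewrite [LHS]mxE [RHS]mxE.
pose h := chart i \o @chart_inv _ M j.
have hjp : (chart j @` chart_dom j) (chart j p) by exists p.
have hh : h (chart j p) = chart i p by rewrite /h /= chartK.
have dh : derivable h (chart j p) (stdbasis F k).
  have Uj : (chart j @` (chart_dom j `&` chart_dom i)) (chart j p) by exists p.
  exact: (smooth_derivable (transition_smooth j i) Uj).
have dfh : differentiable (f \o chart_inv i) (h (chart j p)) by rewrite hh.
have -> : 'D_(stdbasis F k) (f \o chart_inv j) (chart j p) =
          'D_(stdbasis F k) ((f \o chart_inv i) \o h) (chart j p).
  apply: near_eq_derive.
  have nj := @chart_inv_continuous _ M j _ hjp _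
    (open_nbhs_nbhs (conj (@chart_dom_open _ M i) _)).
  have {}nj : \forall y \near chart j p, chart_dom i (chart_inv j y).
    by apply: nj; rewrite chartK.
  by apply: filterS nj => y hy; rewrite /h /= chartK.
rewrite (derive_comp_differentiable dh dfh) (differential_partials _ dfh) hh.
by apply: eq_bigr => l _; rewrite [in RHS]mxE [in RHS]mxE.
Qed.

(** The coefficients found in one chart serve in all of them: both sides of the
    defining equation obey the same transformation law.  Thus [dirder] does not
    fall back on its default value. *)
Lemma dirderE (F : realType) (M : manifold3 F) (a : covector_triple M)
    (f : M -> F) (i : chart_index M) (p : M) :
  coframing a -> chart_dom i p ->
  differentiable (f \o chart_inv i) (chart i p) ->
  differential f i p = dirder a f ix1 p *: a ix1 p i +
    dirder a f ix2 p *: a ix2 p i + dirder a f ix3 p *: a ix3 p i.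
Proof.
move=> fa hi df.
have [c1 [c2 [c3 e]]] :=
  independent_span (differential f i p) (coframing_independent fa hi).
have ex : exists c : 'rV[F]_3, forall j, chart_dom j p ->
    differential f j p = components (\sum_(k < 3) c ord0 k *: a k p) j.
  exists (\row_k fun3 c1 c2 c3 k) => j hj; set s := \sum_(k < 3) _.
  have /asboolP [cs _] := components_covariant s.
  rewrite (differential_transition hi hj df) e (cs j i hj hi); congr (_ *m _).
  by rewrite /s (components_comb _ (fun k => a k p)) !mxE.
have H := xgetPex (0 : 'rV[F]_3) ex.
rewrite -(components_comb (fun k => dirder a f k p) (fun k => a k p)).
exact: (H i hi).
Qed.

Lemma dirder_unique (F : realType) (M : manifold3 F) (a : covector_triple M)
    (f : M -> F) (i : chart_index M) (p : M) c1 c2 c3 :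
  coframing a -> chart_dom i p ->
  differentiable (f \o chart_inv i) (chart i p) ->
  differential f i p = c1 *: a ix1 p i + c2 *: a ix2 p i + c3 *: a ix3 p i ->
  [/\ dirder a f ix1 p = c1, dirder a f ix2 p = c2 & dirder a f ix3 p = c3].
Proof.
move=> fa hi df e; apply: independent_eq (coframing_independent fa hi) _.
by rewrite -dirderE.
Qed.

(** The cross product of the components of a^1 and a^3 is a tangent vector
    killed by a^1 and a^3 but not by a^2; the foliation condition says that w^1
    kills it too. *)
Lemma foliation_span (F : realType) (M : manifold3 F) (a w : covector_triple M)
    (p : M) (i : chart_index M) :
  coframing a -> foliation_condition a w -> chart_dom i p ->
  exists c1 c3, w ix1 p i = c1 *: a ix1 p i + c3 *: a ix3 p i.
Proof.
move=> fa fol hi; have ind := coframing_independent fa hi.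
have [c1 [c2 [c3 e]]] := independent_span (w ix1 p i) ind.
pose W := wedge11 (a ix1 p i) (a ix3 p i).
pose v : 'rV[F]_3 := \row_k fun3 (W ix2 ix3) (W ix3 ix1) (W ix1 ix2) k.
have vE (u : 'cV[F]_3) : v *m u = const_mx (wedge21 W u).
  apply/matrixP => k l; rewrite !ord1 mxE !big_ord_recl big_ord0 addr0 addrA.
  rewrite [RHS]mxE /wedge21 ![v _ _]mxE /=.
  by congr (_ * u _ _ + _ * u _ _ + _ * u _ _); apply: val_inj.
have : foliation_tangent (a ix1) (a ix3) i p v.
  by split; rewrite vE /wedge21 /W !wedge11E; apply/matrixP => k l;
     rewrite !mxE; ring.
rewrite -(fol p i hi) => -[vw _].
have c20 : c2 = 0.
  apply: (mulIf (triple_neq0 ind)).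
  move/matrixP: vw => /(_ ord0 ord0); rewrite vE e !mxE => w0.
  rewrite mul0r -oppr0 -[in RHS]w0 /wedge21 /W !wedge11E !mxE; ring.
by exists c1, c3; rewrite e c20 scale0r addr0.
Qed.

Lemma identified_pair_chart (F : realType) (M : manifold3 F)
    (a w : covector_triple M) (R I K m : M -> F) (i : chart_index M) :
  Cartan_structure R a -> Landsberg_structure I K w ->
  foliation_condition a w -> identification_condition a w K m ->
  identified_pair (chart i @` chart_dom i)
    (fun x => a ix1 (chart_inv i x) i) (fun x => a ix2 (chart_inv i x) i)
    (fun x => a ix3 (chart_inv i x) i) (fun x => w ix1 (chart_inv i x) i)
    (fun x => w ix2 (chart_inv i x) i) (fun x => w ix3 (chart_inv i x) i)
    (R \o chart_inv i) (I \o chart_inv i) (K \o chart_inv i) (m \o chart_inv i)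
    (dirder a m ix1 \o chart_inv i) (dirder a m ix2 \o chart_inv i)
    (dirder a m ix3 \o chart_inv i).
Proof.
move=> [_ fa da] [sI _ fw dw] fol [e1 e2 [sm m0] _ _].
have oU := @chart_open _ M i.
split.
- exact: oU.
- exact: fa.1.
- exact: fa.1.
- exact: fa.1.
- exact: fw.1.
- exact: fw.1.
- exact: fw.1.
- exact: sI.
- exact: sm.
- move=> _ [p hp <-]; rewrite chartK //; exact: coframing_independent.
- by move=> _ [p hp <-]; exact: m0.
- move=> _ [p hp <-]; have [d _ _] := da p i hp.
  rewrite -[RHS]/(wedge (a ix2 _) (a ix3 _) i) chartK // -d.
- move=> _ [p hp <-]; have [_ d _] := da p i hp.
  rewrite -[RHS]/(- wedge (a ix1 _) (a ix3 _) i) chartK // -d.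
- move=> _ [p hp <-]; have [_ _ d] := da p i hp.
  rewrite -[RHS]/(R _ *: wedge (a ix1 _) (a ix2 _) i) chartK // -d.
- move=> _ [p hp <-]; have [d _ _] := dw p i hp.
  rewrite -[RHS]/(- I _ *: wedge (w ix1 _) (w ix3 _) i +
                  wedge (w ix2 _) (w ix3 _) i) chartK // -d.
- move=> _ [p hp <-]; have [_ d _] := dw p i hp.
  rewrite -[RHS]/(- wedge (w ix1 _) (w ix3 _) i) chartK // -d.
- move=> _ [p hp <-]; have [_ _ d] := dw p i hp.
  rewrite -[RHS]/(K _ *: wedge (w ix1 _) (w ix2 _) i) chartK // -d.
- by move=> _ [p hp <-]; rewrite e1.
- by move=> _ [p hp <-]; rewrite e2.
- move=> _ [p hp <-]; rewrite chartK //; exact: foliation_span fa fol hp.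
- move=> _ [p hp <-]; rewrite /= chartK //; apply: (dirderE fa hp).
  exact: smooth_differentiable oU (sm i) (ex_intro2 _ _ p hp erefl).
Qed.

(** * The change of coframing *)

Lemma dirder_inv (F : realType) (M : manifold3 F) (a : covector_triple M)
    (m : M -> F) (p : M) (j : 'I_3) :
  coframing a -> smooth_fun m -> m p != 0 ->
  dirder a (fun q => 1 / m q) j p = - (dirder a m j p / m p ^+ 2).
Proof.
move=> fa sm m0; have [i hi] := chart_dom_cover p.
have Ux : (chart i @` chart_dom i) (chart i p) by exists p.
pose mi := m \o @chart_inv _ M i.
have dm : differentiable mi (chart i p).
  exact: smooth_differentiable (@chart_open _ M i) (sm i) Ux.
have mx : mi (chart i p) = m p by rewrite /mi /= chartK.
have mx0 : mi (chart i p) != 0 by rewrite mx.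
have e : (fun q => 1 / m q) \o chart_inv i = fun y => (mi y)^-1.
  by apply/funext => y /=; rewrite div1r.
have dV : differentiable ((fun q => 1 / m q) \o chart_inv i) (chart i p).
  by rewrite e; exact: differentiableV dm mx0.
have ed : differential (fun q => 1 / m q) i p =
    - (m p ^+ 2)^-1 *: differential m i p.
  apply/colP => k; rewrite mxE e scalemxE [in RHS]mxE -mx.
  exact: deriveV mx0 (diff_derivable dm).
rewrite (dirderE fa hi dm) !scalerDr !scalerA in ed.
have [e1 e2 e3] := dirder_unique fa hi dV ed.
by have [->|->|->] := ord3P j; rewrite ?e1 ?e2 ?e3 mulNr mulrC.
Qed.

Theorem proposition4p3 (F : realType) (Sigma : manifold3 F)
    (alpha omega : covector_triple Sigma) (R I K m : Sigma -> F) :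
  Cartan_structure R alpha ->
  Landsberg_structure I K omega ->
  foliation_condition alpha omega ->
  identification_condition alpha omega K m ->
  (exists A : cotangent_endo Sigma,
     [/\ maps_coframing A alpha omega,
         forall B : cotangent_endo Sigma,
           maps_coframing B alpha omega -> forall p, B p =1 A p &
         has_matrix alpha A (fun p =>
           matrix3 (dirder alpha (fun q => 1 / m q) ix2 p) 0 (1 / m p)
                   (1 / m p)                              0 0
                   0                                      1 0)]) /\
  (forall p, R p = 1 - dirder alpha (dirder alpha m ix2) ix2 p / m p) /\
  (forall p, m p != 0) /\ smooth_fun m /\
  (forall p, dirder alpha m ix3 p = 0) /\
  (forall p, dirder alpha (dirder alpha m ix1) ix2 p = 0) /\
  (forall p, I p = - 2 * (dirder alpha m ix2 p / m p)) /\
  (forall p, K p = m p ^+ 2).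
Proof.
move=> hR hI fol idc.
have [_ fa _] := hR; have [e1 e2 [sm m0] _ mK] := idc.
have P i := identified_pair_chart i hR hI fol idc.
have inU (i : chart_index Sigma) (p : Sigma) (hi : chart_dom i p) :
    (chart i @` chart_dom i) (chart i p).
  by exists p.
have first (p : Sigma) (i : chart_index Sigma) :
    chart_dom i p -> dirder alpha m ix3 p = 0 /\
    omega ix1 p i = - (dirder alpha m ix2 p / m p ^+ 2) *: alpha ix1 p i +
                    (m p)^-1 *: alpha ix3 p i.
  by move=> hi; have := pair_first_order (P i) (inU i p hi); rewrite /= chartK.
have second p : I p = - 2 * (dirder alpha m ix2 p / m p) /\
    R p = 1 - dirder alpha (dirder alpha m ix2) ix2 p / m p.
  have [i hi] := chart_dom_cover p; have Ux := inU i p hi.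
  have [_ _ d2] := pair_differentiable (P i) Ux.
  have so c1 c2 c3 := @pair_second_order _ _ _ _ _ _ _ _ _ _ _ _ _ _ _ _
    c1 c2 c3 (P i) Ux.
  by rewrite /= (chartK hi) in so; exact: so (dirderE fa hi d2).
have mixed p : dirder alpha (dirder alpha m ix1) ix2 p = 0.
  have [i hi] := chart_dom_cover p; have Ux := inU i p hi.
  have [_ d1 _] := pair_differentiable (P i) Ux.
  have mx c1 c2 c3 := @pair_m12_eq0 _ _ _ _ _ _ _ _ _ _ _ _ _ _ _ _
    c1 c2 c3 (P i) Ux.
  by rewrite /= (chartK hi) in mx; exact: mx (dirderE fa hi d1).
split; last first.
  split; first by move=> p; have [] := second p.
  do 2 split => //; split.
    by move=> p; have [i hi] := chart_dom_cover p; have [] := first p i hi.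
  split=> //; split; first by move=> p; have [] := second p.
  by move=> p; rewrite mK.
have [A mA] := coframing_endo omega fa.
exists A; split=> //.
  by move=> B mB; exact: (maps_coframing_unique fa mA mB).
move=> p j; rewrite -mA; have [i hi] := chart_dom_cover p.
apply: (cotangent_eq hi); rewrite (components_comb _ (fun k => alpha k p)).
rewrite !mxE (dirder_inv _ fa sm (m0 p)) div1r.
have [->|->|->] := ord3P j => /=.
- by have [_ ->] := first p i hi; rewrite scale0r addr0.
- have -> : alpha ix1 p i = m p *: omega ix2 p i by rewrite e1.
  by rewrite !scale0r !addr0 scalerA mulVf // scale1r.
- by rewrite e2 !scale0r add0r addr0 scale1r.
Qed.
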